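(* Let $E\to M$ be a holomorphic vector bundle over a compact Kähler manifold $(M,\omega)$. A strongly pseudo-convex Finsler metric $G$ on $E$ is Finsler-Einstein with respect to $\omega$ if and only if the corresponding metric $\phi$ on $\mathcal{O}_{P(E)}(1)\to P(E)$ is geodesic-Einstein with respect to $\omega$.
   Context: Let $r=\mathrm{rank}\,E$, $\omega=\sqrt{-1}g_{\alpha\bar\beta}dz^\alpha\wedge d\bar z^\beta$. A (complex) Finsler metric on $E$ is a continuous function $G:E\to[0,\infty)$, smooth away from the zero section, with $G(z,\zeta)=0$ iff $\zeta=0$ and $G(z,c\zeta)=|c|^2G(z,\zeta)$ for $c\in\mathbb{C}$; it is strongly pseudo-convex if, in fiber coordinates $(\zeta^1,\dots,\zeta^r)$ from a local holomorphic frame, $(G_{i\bar j})=(\partial^2G/\partial\zeta^i\partial\bar\zeta^j)$ is positive definite at all $\zeta\ne0$. Set $$K_{i\bar j\alpha\bar\beta}=-\frac{\partial^2G_{i\bar j}}{\partial z^\alpha\partial\bar z^\beta}+G^{k\bar l}\frac{\partial G_{i\bar l}}{\partial z^\alpha}\frac{\partial G_{k\bar j}}{\partial\bar z^\beta},$$ with $(G^{k\bar l})$ the inverse of $(G_{i\bar j})$; the Kobayashi curvature is $\Psi=\sqrt{-1}K_{i\bar j\alpha\bar\beta}\frac{\zeta^i\bar\zeta^j}{G}dz^\alpha\wedge d\bar z^\beta$. $G$ is Finsler-Einstein with respect to $\omega$ if $g^{\alpha\bar\beta}K_{i\bar j\alpha\bar\beta}\zeta^i\bar\zeta^j/G$ is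 a constant. $P(E)=(E-\{0\})/\mathbb{C}^*$ is the bundle of lines in $E$, with projection $\pi:P(E)\to M$, and $\mathcal{O}_{P(E)}(1)$ is the hyperplane line bundle, dual to the tautological line bundle. A metric on a line bundle is written $e^{-\phi}$ and referred to as $\phi$ ($|e|^2=e^{-\phi}$ for a local holomorphic frame $e$). A Finsler metric $G$ on $E$ is the same as a Hermitian metric on the tautological line bundle; the corresponding metric $\phi$ on $\mathcal{O}_{P(E)}(1)$ is the dual metric, which satisfies $\partial\bar\partial\phi=\partial\bar\partial\log G$. If $G$ is strongly pseudo-convex then $\phi$ is admissible, i.e. $\sqrt{-1}\partial\bar\partial\phi$ is positive on each fiber of $\pi$. In local holomorphic coordinates $(z;v)$ on $P(E)$ with $\pi(z;v)=z$, subscripts $\alpha,\bar\beta$ denote derivatives in $z^\alpha,\bar z^\beta$, subscripts $a,\bar b$ derivatives in the fiber coordinates $v^a,\bar v^b$, and $(\phi^{\bar ba})$ is the inverse of $(\phi_{a\bar b})$. An admissible metric $\phi$ is geodesic-Einstein with respect to $\omega$ if $tr_\omega c(\phi):=g^{\alpha\bar\beta}(\phi_{\alpha\bar\beta}-\phi_{\alpha\bar b}\phi^{\bar ba}\phi_{a\bar\beta})$ is a constant. *)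

(* Defs.v *)
From HB Require Import structures.
From mathcomp Require Import all_boot all_order all_algebra.
From mathcomp Require Import all_classical all_reals all_analysis.
From mathcomp Require Import complex ring.
Set Implicit Arguments.
Unset Strict Implicit.
Unset Printing Implicit Defensive.
Import Order.TTheory GRing.Theory Num.Theory.
Import numFieldNormedType.Exports.
Local Open Scope classical_set_scope.
Local Open Scope ring_scope.

(* The alias makes [R[i]] inherit the topology that MathComp-Analysis puts on
   every [numClosedFieldType]. *)
Definition Cx (R : realType) : numClosedFieldType := R[i].

Definition ofreal (R : realType) (x : R) : Cx R := x%:C%C.

Definition normsq (R : realType) (z : Cx R) : R :=
  complex.Re z ^+ 2 + complex.Im z ^+ 2.

(** * Real and Wirtinger partial derivatives on C^m *)

Section Calculus.
Variables (R : realType) (m : nat).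
Implicit Types (f : 'rV[Cx R]_m -> Cx R) (z u : 'rV[Cx R]_m).

Definition restr_re f z u (t : R) : R := complex.Re (f (z + ofreal t *: u)).
Definition restr_im f z u (t : R) : R := complex.Im (f (z + ofreal t *: u)).

Definition dir_derivable u f z : Prop :=
  derivable (restr_re f z u) 0 1 /\ derivable (restr_im f z u) 0 1.

Definition dirD u f z : Cx R :=
  (derive1 (restr_re f z u) 0 +i* derive1 (restr_im f z u) 0)%C.

(* The real coordinate directions: [rdir j false] is d/dx^j and
   [rdir j true] is d/dy^j, where z^j = x^j + i y^j. *)
Definition rdir (j : 'I_m) (b : bool) : 'rV[Cx R]_m :=
  (if b then 'i else 1) *: delta_mx 0 j.

Fixpoint Ck (k : nat) (D : set 'rV[Cx R]_m) f : Prop :=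
  (forall z, D z -> {for z, continuous f}) /\
  if k is k'.+1 then
    forall j b, (forall z, D z -> dir_derivable (rdir j b) f z) /\
                Ck k' D (dirD (rdir j b) f)
  else True.

Definition smooth (D : set 'rV[Cx R]_m) f : Prop := forall k, Ck k D f.

Definition dz (j : 'I_m) f z : Cx R :=
  (dirD (rdir j false) f z - 'i * dirD (rdir j true) f z) / 2%:R.
Definition dzb (j : 'I_m) f z : Cx R :=
  (dirD (rdir j false) f z + 'i * dirD (rdir j true) f z) / 2%:R.

(* Over the complex numbers this forces [A] to be Hermitian. *)
Definition posdef (A : 'M[Cx R]_m) : Prop :=
  forall v : 'rV[Cx R]_m, v != 0 ->
    0 < \sum_i \sum_j A i j * v 0 i * (v 0 j)^*.

End Calculus.

(** * Complex manifolds *)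

Record chart (R : realType) (n : nat) (M : topologicalType) := Chart {
  cdom : set M;
  cmap : M -> 'rV[Cx R]_n;
  cinv : 'rV[Cx R]_n -> M;
  cdom_open : open cdom;
  cimg_open : open (cmap @` cdom);
  cmapK : forall x, cdom x -> cinv (cmap x) = x;
  cmap_continuous : forall x, cdom x -> {for x, continuous cmap};
  cinv_continuous : forall z, (cmap @` cdom) z -> {for z, continuous cinv} }.

(* [differentiable] is differentiability over the field [Cx R], that is,
   holomorphy.  The atlas is any holomorphic atlas, possibly the maximal one. *)
Record complexManifold (R : realType) (n : nat) := ComplexManifold {
  carrier :> topologicalType;
  atlas : set (chart R n carrier);
  _ : hausdorff_space carrier;
  _ : @second_countable carrier;
  atlas_cover : forall x, exists2 c, atlas c & cdom c x;
  atlas_compat : forall c c', atlas c -> atlas c' ->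
    forall z, (cmap c @` (cdom c `&` cdom c')) z ->
      differentiable (fun z => cmap c' (cinv c z)) z }.
Arguments atlas {R n}.

(** * Kähler metrics *)

(* The form sqrt(-1) g_{alpha bar beta} dz^alpha /\ dbar z^beta, given by its
   components [g c x] at [x] in each chart [c] around [x]. *)
Definition hermitian_form (R : realType) (n : nat) (M : complexManifold R n) :=
  chart R n M -> M -> 'M[Cx R]_n.

Record kahler (R : realType) (n : nat) (M : complexManifold R n)
    (g : hermitian_form M) : Prop := Kahler {
  kahler_posdef : forall c x, atlas M c -> cdom c x -> posdef (g c x);
  kahler_smooth : forall c i j, atlas M c ->
    smooth (cmap c @` cdom c) (fun z => g c (cinv c z) i j);
  kahler_tensor : forall c c', atlas M c -> atlas M c' ->
    forall z, (cmap c @` (cdom c `&` cdom c')) z -> forall i j,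
      g c (cinv c z) i j =
      \sum_k \sum_l g c' (cinv c z) k l
        * dz i (fun z => cmap c' (cinv c z) 0 k) z
        * (dz j (fun z => cmap c' (cinv c z) 0 l) z)^*;
  (* d omega = 0, split into its (2,1) and (1,2) parts *)
  kahler_closed : forall c, atlas M c -> forall z, (cmap c @` cdom c) z ->
    forall i j k,
      dz k (fun z => g c (cinv c z) i j) z = dz i (fun z => g c (cinv c z) k j) z
      /\ dzb k (fun z => g c (cinv c z) i j) z
         = dzb j (fun z => g c (cinv c z) i k) z }.

(** * Holomorphic vector bundles *)

(* A local frame over [fdom].  So that [fvec] is total, it is an arbitrary,
   irrelevant basis of the fiber off [fdom]. *)
Record frame (R : realType) (M : topologicalType) (E : M -> vectType (Cx R))
    (r : nat) := Frame {
  fdom : set M;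
  fvec : forall x, r.-tuple (E x);
  fdom_open : open fdom;
  fvec_basis : forall x, basis_of fullv (fvec x) }.

(* The holomorphic structure is given by local frames covering [M] with
   holomorphic transition functions. *)
Record holBundle (R : realType) (n : nat) (M : complexManifold R n) (r : nat) :=
  HolBundle {
  fiber :> M -> vectType (Cx R);
  frames : set (frame fiber r);
  frames_cover : forall x, exists2 e, frames e & fdom e x;
  frames_compat : forall e e' c, frames e -> frames e' -> atlas M c ->
    forall z, (cmap c @` (cdom c `&` fdom e `&` fdom e')) z -> forall i j : 'I_r,
      differentiable
        (fun z => coord (fvec e' (cinv c z)) j (fvec e (cinv c z))`_i : Cx R) z }.
Arguments frames {R n M r}.

Section Bundle.
Variables (R : realType) (n r : nat) (M : complexManifold R n).
Variable (E : holBundle M r).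
Implicit Types (c : chart R n M) (e : frame E r) (k : 'I_r).

Definition fcomb e (x : M) (zeta : 'rV[Cx R]_r) : E x :=
  \sum_(i < r) zeta 0 i *: (fvec e x)`_i.

(* The coordinates of the points over which both [c] and [e] are defined. *)
Definition zdom c e : set 'rV[Cx R]_n := cmap c @` (cdom c `&` fdom e).

(** ** Finsler metrics *)

(* [G] in the coordinates (z, zeta) of the total space. *)
Definition Gloc (G : forall x, E x -> R) c e (w : 'rV[Cx R]_(n + r)) : R :=
  G (cinv c (lsubmx w)) (fcomb e (cinv c (lsubmx w)) (rsubmx w)).

Record finsler_metric (G : forall x, E x -> R) : Prop := FinslerMetric {
  finsler_ge0 : forall x u, 0 <= G x u;
  finsler_eq0 : forall x u, G x u = 0 <-> u = 0;
  finsler_homog : forall x (a : Cx R) u, G x (a *: u) = normsq a * G x u;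
  finsler_continuous : forall c e, atlas M c -> frames E e ->
    forall w, zdom c e (lsubmx w) -> {for w, continuous (Gloc G c e)};
  finsler_smooth : forall c e, atlas M c -> frames E e ->
    smooth [set w | zdom c e (lsubmx w) /\ rsubmx w != 0]
      (fun w => ofreal (Gloc G c e w)) }.

(* G_{i bar j} *)
Definition Gmx G c e (w : 'rV[Cx R]_(n + r)) : 'M[Cx R]_r :=
  \matrix_(i, j) dz (rshift n i) (dzb (rshift n j)
                   (fun w => ofreal (Gloc G c e w))) w.

Definition strongly_pseudoconvex G : Prop :=
  forall c e, atlas M c -> frames E e ->
  forall w, zdom c e (lsubmx w) -> rsubmx w != 0 -> posdef (Gmx G c e w).

(* Raised indices: G^{k bar l} G_{i bar l} = delta^k_i, so that G^{k bar l} is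
   the (l, k) entry of the inverse matrix. *)
Definition Kcurv G c e (i j : 'I_r) (al be : 'I_n) (w : 'rV[Cx R]_(n + r))
    : Cx R :=
  - dz (lshift r al) (dzb (lshift r be) (fun w => Gmx G c e w i j)) w
  + \sum_(k < r) \sum_(l < r) invmx (Gmx G c e w) l k
      * dz (lshift r al) (fun w => Gmx G c e w i l) w
      * dzb (lshift r be) (fun w => Gmx G c e w k j) w.

Definition finsler_einstein (g : hermitian_form M) (G : forall x, E x -> R)
    : Prop :=
  exists lambda : Cx R, forall c e, atlas M c -> frames E e ->
  forall w, zdom c e (lsubmx w) -> rsubmx w != 0 ->
    \sum_(al < n) \sum_(be < n) \sum_(i < r) \sum_(j < r)
      invmx (g c (cinv c (lsubmx w))) be al * Kcurv G c e i j al be w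
      * rsubmx w 0 i * (rsubmx w 0 j)^* / ofreal (Gloc G c e w) = lambda.

(** ** The projectivized bundle and the hyperplane line bundle *)

(* The fiber of P(E) at [x]: the lines of [E x]. *)
Definition PEfiber (x : M) := {L : {vspace E x} | \dim L == 1%N}.

(* The fiber of the tautological line bundle at the line [L] is [L] itself;
   that of O(1) is its dual. *)
Definition taut (x : M) (L : PEfiber x) := subvs_of (val L).
Definition O1 (x : M) (L : PEfiber x) := 'Hom(taut L, (Cx R)^o).

(* Affine fiber coordinates v on {zeta^k != 0}, numbered by skipping [k]:
   v stands for the line of homogeneous coordinates [aff k v]. *)
Definition aff k (v : 'rV[Cx R]_r.-1) : 'rV[Cx R]_r :=
  \row_i (if unlift k i is Some a then v 0 a else 1).

Lemma fcomb_coord e x zeta k : coord (fvec e x) k (fcomb e x zeta) = zeta 0 k.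
Proof. exact: coord_sum_free (basis_free (fvec_basis e x)). Qed.

Lemma dim_aff e x k v : \dim <[fcomb e x (aff k v)]>%VS == 1%N.
Proof.
rewrite dim_vline eqb1; apply/eqP => u0; have := fcomb_coord e x (aff k v) k.
by rewrite u0 linear0 mxE unlift_none => /esym/eqP; rewrite oner_eq0.
Qed.

Definition PEpoint e x k v : PEfiber x := exist (fun L : {vspace E x} => \dim L == 1%N) _ (dim_aff e x k v).

(* The local frame zeta^k of O(1) over {zeta^k != 0}, dual to the frame of the
   tautological bundle with zeta^k = 1. *)
Definition O1frame e k x (L : PEfiber x) : O1 L :=
  linfun (fun u : taut L => coord (fvec e x) k (vsval u) : (Cx R)^o).

(** ** Metrics on O(1) *)

(* [h x L s] is the squared norm of the element [s] of the fiber. *)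
Definition O1norm := forall (x : M) (L : PEfiber x), O1 L -> R.

(* The weight phi, |e|^2 = exp (- phi), in the coordinates (z, v). *)
Definition weight (h : O1norm) c e k (w : 'rV[Cx R]_(n + r.-1)) : R :=
  - ln (h _ _ (O1frame e k (PEpoint e (cinv c (lsubmx w)) k (rsubmx w)))).

Record O1_metric (h : O1norm) : Prop := O1Metric {
  O1_metric_gt0 : forall x (L : PEfiber x) s, s != 0 -> 0 < h x L s;
  O1_metric_homog : forall x (L : PEfiber x) (a : Cx R) s,
    h x L (a *: s) = normsq a * h x L s;
  O1_metric_smooth : forall c e k, atlas M c -> frames E e ->
    smooth [set w | zdom c e (lsubmx w)] (fun w => ofreal (weight h c e k w)) }.

(* The second derivative phi_{p bar q}. *)
Definition weight2 h c e k (p q : 'I_(n + r.-1)) (w : 'rV[Cx R]_(n + r.-1))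
    : Cx R :=
  dz p (dzb q (fun w => ofreal (weight h c e k w))) w.

(* phi_{a bar b} *)
Definition weight_fib h c e k w : 'M[Cx R]_r.-1 :=
  \matrix_(a, b) weight2 h c e k (rshift n a) (rshift n b) w.

Definition admissible h : Prop :=
  forall c e k, atlas M c -> frames E e ->
  forall w, zdom c e (lsubmx w) -> posdef (weight_fib h c e k w).

(* tr_omega c(phi); phi^{bar b a} is the (b, a) entry of the inverse. *)
Definition tr_c (g : hermitian_form M) h c e k w : Cx R :=
  \sum_(al < n) \sum_(be < n) invmx (g c (cinv c (lsubmx w))) be al *
    (weight2 h c e k (lshift _ al) (lshift _ be) w
     - \sum_(a < r.-1) \sum_(b < r.-1)
         weight2 h c e k (lshift _ al) (rshift n b) w
         * invmx (weight_fib h c e k w) b a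
         * weight2 h c e k (rshift n a) (lshift _ be) w).

Definition geodesic_einstein (g : hermitian_form M) (h : O1norm) : Prop :=
  [/\ O1_metric h, admissible h &
    exists lambda : Cx R, forall c e k, atlas M c -> frames E e ->
    forall w, zdom c e (lsubmx w) -> tr_c g h c e k w = lambda].

(* The metric on O(1) dual to the metric [G] of the tautological bundle:
   |s|^2 = |s(u)|^2 / G(u) for any generator u of the line (see [dual_metricE]). *)
Definition dual_metric (G : forall x, E x -> R) : O1norm :=
  fun x L s => let u : taut L := vpick fullv in normsq (s u) / G x (vsval u).

Lemma dual_metricE G x (L : PEfiber x) (s : O1 L) (u : taut L) :
  finsler_metric G -> dual_metric G s * G x (vsval u) = normsq (s u).
Proof.
move=> FG; rewrite /dual_metric; set p := vpick fullv.
have dimL : \dim {:taut L} = 1%N by rewrite dimvf; apply/eqP; case: L s u p.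
have p0 : p != 0 by rewrite vpick0 -dimv_eq0 dimL.
have /vlineP[a ->] : u \in <[p]>%VS.
  suff -> : <[p]>%VS = fullv by exact: memvf.
  by apply/eqP; rewrite eqEdim subvf dimL dim_vline p0.
have Gp : G x (vsval p) != 0.
  apply/negP => /eqP/(finsler_eq0 FG) p00; move/eqP: p0; apply.
  by apply/val_inj; exact: etrans p00 (esym (linear0 _)).
have normsqM (b c : Cx R) : normsq (b * c) = normsq b * normsq c.
  by case: b c => [b1 b2] [c1 c2]; rewrite /normsq/=; ring.
rewrite !linearZ/= (finsler_homog FG) -[a *: s p]/(a * s p) normsqM.
by field.
Qed.

End Bundle.

(* Main.v *)
Require Import Defs.
From mathcomp Require Import all_boot all_order all_algebra.
From mathcomp Require Import all_classical all_reals all_analysis.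
From mathcomp Require Import complex ring lra.
Set Implicit Arguments.
Unset Strict Implicit.
Unset Printing Implicit Defensive.
Import Order.TTheory GRing.Theory Num.Theory.
Import numFieldNormedType.Exports.
Local Open Scope classical_set_scope.
Local Open Scope ring_scope.

(** Fix coordinates z on M and zeta on the fibers of E, so that the Finsler metric
    is a function G(z, zeta), and let k and c be such that zeta = c (v, 1), where
    the entry 1 is at the place k and v are affine coordinates on P(E).

    The weight of the dual metric is phi = log G(z, (v, 1)), which by homogeneity
    is log G(z, zeta) up to a constant ([weight_dual_scale]).  The theorem
    follows from the pointwise identity

      K_{i jb al beb} zeta^i zetab^j / G
        = - (phi_{al beb} - phi_{al bb} phi^{bb a} phi_{a beb}),

    whose trace is [tr_c_dual]: one side is constant if and only if the other is,
    with opposite constants.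

    For the left-hand side, the homogeneity G(z, c zeta) = |c|^2 G(z, zeta) gives
    Euler's identities zeta^i G_i = G, zeta^i G_{i jb} = G_jb and
    zetab^j G_{i jb} = G_i, together with their derivatives along M ([euler],
    [euler_dz], [euler_dzb]).  They turn the contraction of K into
    - (G_{al beb} - G_{al lb} G^{k lb} G_{k beb}), minus the Schur complement of
    the fiber block in the Levi form of G ([curvature_contraction]).

    The right-hand side is minus the Schur complement of the fiber block in the Levi
    form of log G, taken in a chart transversal to zeta.  The fiber Levi form of
    log G has zeta in its kernel, and a computation in linear algebra
    ([schur_projective], [log_schur]) shows that this Schur complement is that of
    G divided by G.  Admissibility of phi, which includes the invertibility of
    (phi_{a bb}), is the strict Cauchy-Schwarz inequality for the fiber metric
    ([log_levi_gt0], [posdef_fib_levi]).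

    The calculus rests on real directional derivatives.  Continuity of the partial
    derivatives is used twice: for the linearity of the derivative in the
    direction ([is_dirD_expand]), which Euler's identities and the rescaling by c
    require, and for the exchange of two derivatives ([wirt_comm]). *)

(** * Functions of two real variables *)

Section TwoVariables.
Variable R : realType.
Implicit Types (F : R -> R -> R).

Lemma near_box (P : R * R -> Prop) :
  (\forall p \near ((0, 0) : R * R), P p) ->
  exists2 d : R, 0 < d & forall s t, `|s| < d -> `|t| < d -> P (s, t).
Proof.
move=> /nbhs_ballP[d /= d0 dP]; exists d => // s t sd td; apply: dP.
by split; rewrite /ball/= sub0r normrN.
Qed.

Lemma continuous_box (c : R -> R -> R) (e : R) :
  {for (0, 0), continuous (fun p : R * R => c p.1 p.2)} -> 0 < e ->
  exists2 d : R, 0 < d &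
    forall s t, `|s| < d -> `|t| < d -> `|c 0 0 - c s t| < e.
Proof.
move=> cc e0; have /cvgrPdist_lt/(_ e e0)/near_box[d d0 dP] := cc.
by exists d => // s t sd td; exact: dP.
Qed.

Lemma MVT_origin (f df : R -> R) (t : R) :
  (forall x : R, `|x| <= `|t| -> is_derive x 1 f (df x)) ->
  exists2 c, `|c| <= `|t| & f t - f 0 = df c * t.
Proof.
move=> fdf.
have cf a b : `|a| <= `|t| -> `|b| <= `|t| -> {within `[a, b], continuous f}.
  move=> la lb; apply: derivable_within_continuous => x; rewrite in_itv/= => /andP[ax xb].
  have xt : `|x| <= `|t| by move: la lb; rewrite !ler_norml; lra.
  by have [] := fdf x xt.
have [t0|t0] := leP 0 t.
- have [||c] := @MVT_segment _ f df 0 t t0.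
  + move=> x; rewrite in_itv/= => /andP[x0 xt]; apply: fdf.
    by rewrite (ger0_norm t0) ger0_norm ltW.
  + by apply: cf; rewrite ?normr0.
  rewrite in_itv/= subr0 => /andP[c0 ct] E; exists c => //.
  by rewrite (ger0_norm t0) ger0_norm.
- have [||c] := @MVT_segment _ f df t 0 (ltW t0).
  + move=> x; rewrite in_itv/= => /andP[x0 xt]; apply: fdf.
    by rewrite (ltr0_norm t0) ltr0_norm// lerN2 ltW.
  + by apply: cf; rewrite ?normr0.
  rewrite in_itv/= sub0r => /andP[tc c0] E; exists c.
    by rewrite (ltr0_norm t0) ler0_norm// lerN2.
  by rewrite -opprB E mulrN opprK.
Qed.

(** The increment F(t,t) - F(0,t) is, by the mean value theorem, t times a value
    of Fs near the origin.  Continuity is asked of Fs alone, which is what allows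
    directions to be added one at a time. *)
Lemma is_derive_diag F (Fs : R -> R -> R) (l : R) :
  (\forall p \near ((0, 0) : R * R),
     is_derive (p.1 : R) (1 : R) (fun s => F s p.2) (Fs p.1 p.2)) ->
  {for (0, 0), continuous (fun p : R * R => Fs p.1 p.2)} ->
  is_derive (0 : R) 1 (F 0) l ->
  is_derive (0 : R) 1 (fun t => F t t) (Fs 0 0 + l).
Proof.
move=> /near_box[d d0 dF] cFs Fl.
suff: is_derive (0 : R) 1 ((fun t => F t t) - F 0) (Fs 0 0).
  by move=> H; have := is_deriveD H Fl; rewrite subrK.
suff H : h^-1 *: ((((fun t => F t t) - F 0) \o shift 0) (h *: 1) -
    ((fun t => F t t) - F 0) 0) @[h --> 0^'] --> Fs 0 0.
  apply: DeriveDef; first by apply/cvg_ex; exists (Fs 0 0).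
  exact: cvg_lim H.
apply/cvgrPdist_lt => e e0.
have [d' d'0 d'F] := continuous_box cFs e0.
near=> h; rewrite /= addr0 [h *: 1]mulr1.
have h0 : h != 0 by near: h; exact: nbhs_dnbhs_neq.
have hd : `|h| < Num.min d d' by near: h; apply: dnbhs0_lt; rewrite lt_min d0.
move: hd; rewrite lt_min => /andP[hd hd'].
have [x xh] := @MVT_origin (fun s => F s h) (fun s => Fs s h) h
  (fun x xh => dF x h (le_lt_trans xh hd) hd).
move=> E; rewrite !fctE subrr subr0 E [_ *: _]mulrC mulfK//.
exact: d'F (le_lt_trans xh hd') hd'.
Unshelve. all: by end_near. Qed.

Lemma mixed_partials_eq F (Fs Ft Fst Fts : R -> R -> R) :
  (\forall p \near ((0, 0) : R * R),
    [/\ is_derive (p.1 : R) (1 : R) (fun s => F s p.2) (Fs p.1 p.2),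
        is_derive (p.2 : R) (1 : R) (F p.1) (Ft p.1 p.2),
        is_derive (p.2 : R) (1 : R) (Fs p.1) (Fst p.1 p.2) &
        is_derive (p.1 : R) (1 : R) (fun s => Ft s p.2) (Fts p.1 p.2)]) ->
  {for (0, 0), continuous (fun p : R * R => Fst p.1 p.2)} ->
  {for (0, 0), continuous (fun p : R * R => Fts p.1 p.2)} ->
  Fst 0 0 = Fts 0 0.
Proof.
move=> /near_box[d d0 dF] cst cts; apply/eqP; rewrite -subr_eq0; apply/eqP.
apply/normr0_eq0/eqP; rewrite eq_le normr_ge0 andbT; apply/ler_addgt0Pl => e e0.
rewrite addr0.
have e20 : 0 < e / 2 by rewrite divr_gt0.
have [d1 d10 d1F] := continuous_box cst e20.
have [d2 d20 d2F] := continuous_box cts e20.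
pose h := Num.min d (Num.min d1 d2) / 2.
have m0 : 0 < Num.min d (Num.min d1 d2) by rewrite !lt_min d0 d10.
have h0 : 0 < h by rewrite divr_gt0.
have : h < Num.min d (Num.min d1 d2) by rewrite ltr_pdivrMr// ltr_pMr// ltr1n.
rewrite !lt_min => /and3P[hd hd1 hd2].
have lt_h (x D : R) : `|x| <= `|h| -> h < D -> `|x| < D.
  by move=> xh; apply: le_lt_trans; rewrite (le_trans xh)// gtr0_norm.
have hh (D : R) : h < D -> `|h| < D by move=> ?; apply: lt_h.
have z (D : R) : 0 < D -> `|0 : R| < D by rewrite normr0.
(* E1, E2 and E3, E4 evaluate the same second difference of F over the square
   [0, h]^2, first along s and first along t. *)
have [x xh E1] := @MVT_origin (fun s => F s h - F s 0)
   (fun s => Fs s h - Fs s 0) h (fun x xh =>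
   is_deriveB (let: And4 a _ _ _ := dF x h (lt_h _ _ xh hd) (hh _ hd) in a)
              (let: And4 a _ _ _ := dF x 0 (lt_h _ _ xh hd) (z _ d0) in a)).
have [y yh E2] := @MVT_origin (Fs x) (Fst x) h (fun y yh =>
   let: And4 _ _ a _ := dF x y (lt_h _ _ xh hd) (lt_h _ _ yh hd) in a).
have [y' yh' E3] := @MVT_origin (fun t => F h t - F 0 t)
   (fun t => Ft h t - Ft 0 t) h (fun t th =>
   is_deriveB (let: And4 _ a _ _ := dF h t (hh _ hd) (lt_h _ _ th hd) in a)
              (let: And4 _ a _ _ := dF 0 t (z _ d0) (lt_h _ _ th hd) in a)).
have [x' xh' E4] := @MVT_origin (fun s => Ft s y') (fun s => Fts s y') h (fun s sh =>
   let: And4 _ _ _ a := dF s y' (lt_h _ _ sh hd) (lt_h _ _ yh' hd) in a).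
have E : Fst x y = Fts x' y'.
  have h2 : h * h != 0 by rewrite mulf_neq0// gt_eqF.
  apply: (mulIf h2); rewrite mulrA -E2 -E1 mulrA -E4 -E3; ring.
have A := d1F x y (lt_h _ _ xh hd1) (lt_h _ _ yh hd1).
have B := d2F x' y' (lt_h _ _ xh' hd2) (lt_h _ _ yh' hd2).
move: A B; rewrite /= -E => A B.
rewrite -[Fst 0 0](subrK (Fst x y)) -addrA (le_trans (ler_normD _ _))//.
by rewrite [e]splitr lerD ?ltW//; rewrite distrC in B.
Qed.

End TwoVariables.

(** * Continuity in complex coordinates *)

Section ComplexTopology.
Variable R : realType.

Lemma Re_continuous : continuous (@complex.Re R : Cx R -> R).
Proof.
move=> z; apply/(@cvgrPdist_lt _ _ _ (nbhs z)) => e e0.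
have e0' : 0 < ofreal e by rewrite ltcR.
apply/nbhs_ballP; exists (ofreal e) => // w; rewrite /ball/= => zw.
rewrite -ltcR; apply: le_lt_trans zw.
by rewrite (_ : _ - _ = complex.Re (z - w)) ?normc_ge_Re//; case: z; case: w.
Qed.

Lemma Im_continuous : continuous (@complex.Im R : Cx R -> R).
Proof.
move=> z; apply/(@cvgrPdist_lt _ _ _ (nbhs z)) => e e0.
have e0' : 0 < ofreal e by rewrite ltcR.
apply/nbhs_ballP; exists (ofreal e) => // w; rewrite /ball/= => zw.
rewrite -ltcR; apply: le_lt_trans zw.
have <- : `|'i%C * (z - w)| = `|z - w| by rewrite normrM (@normCi R[i]) mul1r.
rewrite -normrN opprB.
rewrite (_ : _ - _ = complex.Re ('i%C * (z - w))) ?normc_ge_Re//.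
case: z; case: w => a b c d.
by rewrite /=; ring.
Qed.

Lemma ofreal_continuous : continuous (@ofreal R).
Proof.
move=> x; apply/cvgrPdist_lt => e; rewrite ltcE => /andP[/= /eqP ie re].
apply/nbhs_ballP; exists (complex.Re e) => // y; rewrite /ball/= => xy.
rewrite /ofreal -rmorphB/= normc_def/= expr0n/= addr0 sqrtr_sqr ltcE/= ie eqxx.
exact: xy.
Qed.

Lemma continuous_ext (T : topologicalType) (h1 h2 : T -> Cx R) (x : T) :
  h1 =1 h2 -> {for x, continuous h1} -> {for x, continuous h2}.
Proof. by move=> /funext ->. Qed.

Lemma rV_continuous (T : topologicalType) m (h : T -> 'rV[Cx R]_m) (x : T) :
  (forall j, {for x, continuous (fun y => h y 0 j)}) -> {for x, continuous h}.
Proof.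
move=> ch; apply/cvg_ballP => e e0.
have H : \forall y \near x, forall j, ball (h x 0 j) e (h y 0 j).
  apply: filter_forall => j.
  by have /cvg_ballP/(_ e e0) := ch j.
apply: filterS H => y hy; split=> // i j; rewrite ord1; exact: hy.
Qed.

Lemma continuous_coord m (j : 'I_m) : continuous (fun w : 'rV[Cx R]_m => w 0 j).
Proof. exact: coord_continuous. Qed.

Lemma open_neq0 m : open [set w : 'rV[Cx R]_m | w != 0].
Proof.
rewrite openE => w /= w0; have [j wj] : exists j, w 0 j != 0.
  apply/existsP; apply: contra_neqT w0; rewrite negb_exists => /forallP H.
  by apply/rowP => j; rewrite mxE; apply/eqP; move: (H j); rewrite negbK.
have /cvg_ballP/(_ `|w 0 j|) := @continuous_coord m j w.
rewrite normr_gt0 => /(_ wj); apply: filterS => v; rewrite /ball/= => vj.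
by apply: contraTneq vj => ->; rewrite mxE subr0 ltxx.
Qed.

End ComplexTopology.

(** * Directional derivatives *)

Section DirectionalDerivative.
Variables (R : realType) (m : nat).
Implicit Types (f g : 'rV[Cx R]_m -> Cx R) (F : 'rV[Cx R]_m -> R).
Implicit Types (z u v : 'rV[Cx R]_m) (l : Cx R).

Lemma Re_ofreal (x : R) : complex.Re (ofreal x) = x. Proof. by []. Qed.
Lemma Im_ofreal (x : R) : complex.Im (ofreal x) = 0. Proof. by []. Qed.

Lemma cReD (a b : Cx R) : complex.Re (a + b) = complex.Re a + complex.Re b.
Proof. by case: a b => [? ?] []. Qed.
Lemma cImD (a b : Cx R) : complex.Im (a + b) = complex.Im a + complex.Im b.
Proof. by case: a b => [? ?] []. Qed.
Lemma cReM (a b : Cx R) : complex.Re (a * b) =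
  complex.Re a * complex.Re b - complex.Im a * complex.Im b.
Proof. by case: a b => [? ?] []. Qed.
Lemma cImM (a b : Cx R) : complex.Im (a * b) =
  complex.Re a * complex.Im b + complex.Im a * complex.Re b.
Proof. by case: a b => [? ?] []. Qed.
Lemma cRe_conj (a : Cx R) : complex.Re a^* = complex.Re a.
Proof. by case: a. Qed.
Lemma cIm_conj (a : Cx R) : complex.Im a^* = - complex.Im a.
Proof. by case: a. Qed.

Lemma Cx_eq (a b : Cx R) :
  complex.Re a = complex.Re b -> complex.Im a = complex.Im b -> a = b.
Proof. by case: a b => [? ?] [? ?] /= -> ->. Qed.

Lemma is_derive_ext (h k : R -> R) (x l : R) : h =1 k ->
  is_derive (x : R) (1 : R) h l -> is_derive (x : R) (1 : R) k l.
Proof. by move=> /funext ->. Qed.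

(** Derivability and value of the derivative in one statement: [dirD] alone is
    a default value where [f] has no derivative. *)
Definition is_dirD u f z l : Prop :=
  is_derive (0 : R) (1 : R) (restr_re f z u) (complex.Re l) /\
  is_derive (0 : R) (1 : R) (restr_im f z u) (complex.Im l).

Lemma dirDP u f z : dir_derivable u f z -> is_dirD u f z (dirD u f z).
Proof.
case=> /derivableP dr /derivableP di.
by split; rewrite [X in is_derive _ _ _ X]derive1E.
Qed.

Lemma is_dirD_derivable u f z l : is_dirD u f z l -> dir_derivable u f z.
Proof. by case=> -[dr _] [di _]; split; [exact: dr|exact: di]. Qed.

Lemma is_dirDE u f z l : is_dirD u f z l -> dirD u f z = l.
Proof.
by move=> [[_ dr] [_ di]]; apply: Cx_eq; rewrite /dirD/= derive1E ?dr ?di.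
Qed.

Lemma is_dirD_eq u f z l l' : is_dirD u f z l -> l = l' -> is_dirD u f z l'.
Proof. by move=> ? <-. Qed.

Lemma is_dirD_near u f g z l :
  (\forall t \near (0 : R), f (z + ofreal t *: u) = g (z + ofreal t *: u)) ->
  is_dirD u f z l -> is_dirD u g z l.
Proof.
move=> fg [dr di]; split.
- by apply: near_eq_is_derive dr; apply: filterS fg => t; rewrite /restr_re => ->.
- by apply: near_eq_is_derive di; apply: filterS fg => t; rewrite /restr_im => ->.
Qed.

(** A directional derivative only sees the line that carries it: the two
    functions may differ off that line. *)
Lemma dirD_near u f g z :
  (\forall t \near (0 : R), f (z + ofreal t *: u) = g (z + ofreal t *: u)) ->
  dirD u f z = dirD u g z.
Proof.
move=> fg; rewrite /dirD !derive1E; congr (_ +i* _)%C; apply: near_eq_derive.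
- by apply: filterS fg => t; rewrite /restr_re => ->.
- by apply: filterS fg => t; rewrite /restr_im => ->.
Qed.

Lemma is_dirD_cst u z c : is_dirD u (fun=> c) z 0.
Proof. by split; exact: is_derive_cst. Qed.

Lemma is_dirDD u f g z l k : is_dirD u f z l -> is_dirD u g z k ->
  is_dirD u (fun w => f w + g w) z (l + k).
Proof.
move=> [fr fi] [gr gi]; split.
- rewrite cReD (_ : restr_re _ _ _ = restr_re f z u + restr_re g z u).
    exact: is_deriveD.
  by apply/funext => t; rewrite /restr_re cReD.
- rewrite cImD (_ : restr_im _ _ _ = restr_im f z u + restr_im g z u).
    exact: is_deriveD.
  by apply/funext => t; rewrite /restr_im cImD.
Qed.

Lemma is_dirDM u f g z l k : is_dirD u f z l -> is_dirD u g z k ->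
  is_dirD u (fun w => f w * g w) z (l * g z + f z * k).
Proof.
have z0 : z + ofreal (0 : R) *: u = z by rewrite scale0r addr0.
move=> [fr fi] [gr gi]; split.
- rewrite (_ : restr_re _ _ _ =
    restr_re f z u * restr_re g z u - restr_im f z u * restr_im g z u).
    apply: is_derive_eq (is_deriveB (is_deriveM fr gr) (is_deriveM fi gi)) _.
    rewrite cReD !cReM /restr_re /restr_im z0 ![_ *: _]mulrC; ring.
  by apply/funext => t; rewrite /restr_re cReM.
- rewrite (_ : restr_im _ _ _ =
    restr_re f z u * restr_im g z u + restr_im f z u * restr_re g z u).
    apply: is_derive_eq (is_deriveD (is_deriveM fr gi) (is_deriveM fi gr)) _.
    rewrite cImD !cImM /restr_re /restr_im z0 ![_ *: _]mulrC; ring.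
  by apply/funext => t; rewrite /restr_im cImM.
Qed.

Lemma is_dirDZ u f z l (c : Cx R) : is_dirD u f z l ->
  is_dirD u (fun w => c * f w) z (c * l).
Proof.
move=> fl; apply: is_dirD_eq (is_dirDM (is_dirD_cst u z c) fl) _.
by rewrite mul0r add0r.
Qed.

Lemma is_dirD_sum (I : finType) u (f : I -> 'rV[Cx R]_m -> Cx R) z
    (l : I -> Cx R) : (forall i, is_dirD u (f i) z (l i)) ->
  is_dirD u (fun w => \sum_i f i w) z (\sum_i l i).
Proof.
move=> fl; elim: (index_enum I) => [|i s IH].
  by under eq_fun do rewrite big_nil; rewrite big_nil; exact: is_dirD_cst.
by under eq_fun do rewrite big_cons; rewrite big_cons; exact: is_dirDD.
Qed.

Lemma is_dirD_conj u f z l : is_dirD u f z l -> is_dirD u (fun w => (f w)^*) z l^*.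
Proof.
move=> [fr fi]; split.
- rewrite cRe_conj (_ : restr_re _ _ _ = restr_re f z u)//.
  by apply/funext => t; rewrite /restr_re cRe_conj.
- rewrite cIm_conj (_ : restr_im _ _ _ = - restr_im f z u).
    exact: is_deriveN.
  by apply/funext => t; rewrite /restr_im cIm_conj.
Qed.

Lemma dirD_real u F z : complex.Im (dirD u (fun w => ofreal (F w)) z) = 0.
Proof.
rewrite /dirD/= derive1E (_ : restr_im _ _ _ = cst 0) ?derive_cst//.
Qed.

Lemma is_dirD_real u F z l : is_dirD u (fun w => ofreal (F w)) z l ->
  is_derive (0 : R) (1 : R) (fun t => F (z + ofreal t *: u)) (complex.Re l) /\
  l = ofreal (complex.Re l).
Proof.
move=> Fl; split; first by case: Fl.
by have := dirD_real u F z; rewrite (is_dirDE Fl) => i0; apply: Cx_eq.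
Qed.

Lemma real_is_dirD u F z (l : R) :
  is_derive (0 : R) (1 : R) (fun t => F (z + ofreal t *: u)) l ->
  is_dirD u (fun w => ofreal (F w)) z (ofreal l).
Proof. by move=> Fl; split => //; exact: is_derive_cst. Qed.

Lemma ofrealM (x y : R) : ofreal (x * y) = ofreal x * ofreal y.
Proof. exact: rmorphM. Qed.
Lemma ofrealN (x : R) : ofreal (- x) = - ofreal x.
Proof. exact: rmorphN. Qed.
Lemma ofrealD (x y : R) : ofreal (x + y) = ofreal x + ofreal y.
Proof. exact: rmorphD. Qed.
Lemma ofrealV (x : R) : ofreal x^-1 = (ofreal x)^-1.
Proof. exact: fmorphV. Qed.
Lemma ofreal_eq0 (x : R) : (ofreal x == 0) = (x == 0).
Proof. exact: fmorph_eq0. Qed.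

Lemma is_dirDV_real u F z l : F z != 0 ->
  is_dirD u (fun w => ofreal (F w)) z l ->
  is_dirD u (fun w => ofreal (F w)^-1) z (- l / ofreal (F z) ^+ 2).
Proof.
have z0 : z + ofreal (0 : R) *: u = z by rewrite scale0r addr0.
move=> Fz0 /is_dirD_real[Fl ->].
have : is_derive (0 : R) (1 : R) (fun t => (F (z + ofreal t *: u))^-1)
    (- (F z) ^- 2 *: complex.Re l).
  by have := @is_deriveV R (fun t => F (z + ofreal t *: u)) 0 _ 1; rewrite z0; apply.
move=> H; apply: is_dirD_eq (@real_is_dirD u (fun w => (F w)^-1) z _ H) _.
by rewrite /GRing.scale/= ofrealM ofrealN ofrealV expr2 ofrealM mulNr mulrC mulNr.
Qed.

Lemma is_dirD_ln_real u F z l : 0 < F z ->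
  is_dirD u (fun w => ofreal (F w)) z l ->
  is_dirD u (fun w => ofreal (ln (F w))) z (l / ofreal (F z)).
Proof.
have z0 : z + ofreal (0 : R) *: u = z by rewrite scale0r addr0.
move=> Fz0 /is_dirD_real[Fl ->].
rewrite -ofrealV -ofrealM; apply: real_is_dirD.
have lnd : is_derive (F (z + ofreal 0 *: u)) (1 : R) (@ln R) (F z)^-1.
  by rewrite z0; exact: is_derive1_ln.
by apply: is_derive_eq (is_derive1_comp lnd Fl) _; rewrite mulrC.
Qed.

Lemma is_derive_comp_shift (h : R -> R) (s l : R) :
  is_derive (0 : R) (1 : R) h l -> is_derive s (1 : R) (fun t => h (t - s)) l.
Proof.
move=> hl.
have aff : is_derive (s : R) (1 : R) (fun t => t - s) 1.
  apply: is_derive_eq (is_deriveB (is_derive_id _ _) (is_derive_cst _ _ _)) _.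
  by rewrite subr0.
have hl' : is_derive ((fun t => t - s) s) (1 : R) h l by rewrite subrr.
apply: is_derive_eq (@is_derive1_comp R h (fun t => t - s) s l 1 hl' aff) _.
by rewrite mulr1.
Qed.

Lemma is_derive_comp_scale (h : R -> R) (s l : R) :
  is_derive (0 : R) (1 : R) h l ->
  is_derive (0 : R) (1 : R) (fun t => h (t * s)) (s * l).
Proof.
move=> hl.
have aff : is_derive (0 : R) (1 : R) (fun t : R => t * s) s.
  apply: is_derive_eq (is_deriveM (is_derive_id _ _) (is_derive_cst _ _ _)) _.
  by rewrite scaler0 add0r [_ *: _]mulr1.
have hl' : is_derive ((fun t => t * s) 0) (1 : R) h l by rewrite mul0r.
apply: is_derive_eq (@is_derive1_comp R h (fun t => t * s) 0 l s hl' aff) _.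
by rewrite mulrC.
Qed.

(** The mean value theorem needs the derivative along a line at all of its
    points, whereas [dirD] differentiates at the parameter 0. *)
Lemma is_dirD_shift u f z (s : R) l : is_dirD u f (z + ofreal s *: u) l ->
  is_derive (s : R) (1 : R) (restr_re f z u) (complex.Re l) /\
  is_derive (s : R) (1 : R) (restr_im f z u) (complex.Im l).
Proof.
have E t : z + ofreal t *: u = z + ofreal s *: u + ofreal (t - s) *: u.
  by rewrite -addrA -scalerDl -ofrealD [s + _]addrC subrK.
move=> [/is_derive_comp_shift fr /is_derive_comp_shift fi]; split.
- by apply: is_derive_ext (fr s) => t; rewrite /restr_re -E.
- by apply: is_derive_ext (fi s) => t; rewrite /restr_im -E.
Qed.

Lemma is_dirD_scale u f z (s : R) l : is_dirD u f z l ->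
  is_dirD (ofreal s *: u) f z (ofreal s * l).
Proof.
have E t : ofreal t *: (ofreal s *: u) = ofreal (t * s) *: u.
  by rewrite scalerA -ofrealM.
move=> [/is_derive_comp_scale fr /is_derive_comp_scale fi]; split.
- rewrite cReM Re_ofreal Im_ofreal mul0r subr0.
  by apply: is_derive_ext (fr s) => t; rewrite /restr_re E.
- rewrite cImM Re_ofreal Im_ofreal mul0r addr0.
  by apply: is_derive_ext (fi s) => t; rewrite /restr_im E.
Qed.

Lemma is_dirD0 f z : is_dirD 0 f z 0.
Proof.
split; [rewrite (_ : restr_re _ _ _ = cst (complex.Re (f z)))|
  rewrite (_ : restr_im _ _ _ = cst (complex.Im (f z)))]; do ?exact: is_derive_cst.
- by apply/funext => t; rewrite /restr_re scaler0 addr0.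
- by apply/funext => t; rewrite /restr_im scaler0 addr0.
Qed.

Lemma plane_continuous z u v :
  continuous (fun p : R * R => z + ofreal p.1 *: u + ofreal p.2 *: v).
Proof.
move=> p; apply: cvgD; [apply: cvgD; first exact: cvg_cst|]; apply: cvgZl.
- exact: (continuous_comp cvg_fst (@ofreal_continuous _ _)).
- exact: (continuous_comp cvg_snd (@ofreal_continuous _ _)).
Qed.

Lemma plane_near (D : set 'rV[Cx R]_m) z u v : open D -> D z ->
  \forall p \near ((0, 0) : R * R), D (z + ofreal p.1 *: u + ofreal p.2 *: v).
Proof.
move=> oD Dz; apply: (@plane_continuous z u v (0, 0)); apply: open_nbhs_nbhs.
by split => //=; rewrite !scale0r !addr0.
Qed.

Lemma line_near (D : set 'rV[Cx R]_m) z u : open D -> D z ->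
  \forall t \near (0 : R), D (z + ofreal t *: u).
Proof.
move=> oD Dz.
have /near_box[d d0 dD] := plane_near u 0 oD Dz.
apply/nbhs_ballP; exists d => // t; rewrite /ball/= sub0r normrN => td.
by have := dD t 0 td; rewrite normr0 /= scaler0 addr0; exact.
Qed.

Lemma dirD_open (D : set 'rV[Cx R]_m) u f g z : open D -> D z ->
  (forall w, D w -> f w = g w) -> dirD u f z = dirD u g z.
Proof.
move=> oD Dz fg; apply: dirD_near.
by apply: filterS (line_near u oD Dz) => t; exact: fg.
Qed.

Lemma plane_comp_continuous (D : set 'rV[Cx R]_m) f z u v :
  (forall w, D w -> {for w, continuous f}) -> D z ->
  {for (0, 0), continuous
     (fun p : R * R => f (z + ofreal p.1 *: u + ofreal p.2 *: v))}.
Proof.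
move=> cf Dz.
apply: (@continuous_comp _ _ _
  (fun p : R * R => z + ofreal p.1 *: u + ofreal p.2 *: v) f).
  exact: plane_continuous.
by apply: cf; rewrite /= !scale0r !addr0.
Qed.

(** On the plane z + s u + t v, the derivative along u + v is that of the
    diagonal s = t. *)
Lemma is_dirD_add (D : set 'rV[Cx R]_m) u v f z l : open D -> D z ->
  (forall w, D w -> dir_derivable u f w) ->
  (forall w, D w -> {for w, continuous (dirD u f)}) ->
  is_dirD v f z l ->
  is_dirD (u + v) f z (dirD u f z + l).
Proof.
move=> oD Dz duf cduf [fr fi].
have nearD := plane_near u v oD Dz.
have c0 := @plane_comp_continuous D _ z u v cduf Dz.
pose P s t := z + ofreal s *: u + ofreal t *: v.
have E s t : P s t = z + ofreal t *: v + ofreal s *: u by rewrite /P addrAC.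
have E1 t : z + ofreal t *: (u + v) = P t t by rewrite /P scalerDr addrA.
have E0 t : z + ofreal t *: v = P 0 t by rewrite /P scale0r addr0.
have Z : P 0 0 = z by rewrite /P !scale0r !addr0.
split.
- have H1 : \forall p \near ((0, 0) : R * R), is_derive (p.1 : R) (1 : R)
      (fun s => complex.Re (f (P s p.2))) (complex.Re (dirD u f (P p.1 p.2))).
    apply: filterS nearD => -[s t]/=; rewrite -/(P s t) E => /duf/dirDP/is_dirD_shift[H _].
    by apply: is_derive_ext H => s'; rewrite /restr_re E.
  have H2 : {for (0, 0), continuous
      (fun p : R * R => complex.Re (dirD u f (P p.1 p.2)))}.
    exact: (continuous_comp c0 (@Re_continuous _ _)).
  have H3 : is_derive (0 : R) (1 : R) (fun t => complex.Re (f (P 0 t))) (complex.Re l).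
    by apply: is_derive_ext fr => t; rewrite /restr_re E0.
  have := @is_derive_diag R (fun s t => complex.Re (f (P s t)))
    (fun s t => complex.Re (dirD u f (P s t))) _ H1 H2 H3.
  rewrite Z -cReD; apply: is_derive_ext => t.
  by rewrite /restr_re E1.
- have H1 : \forall p \near ((0, 0) : R * R), is_derive (p.1 : R) (1 : R)
      (fun s => complex.Im (f (P s p.2))) (complex.Im (dirD u f (P p.1 p.2))).
    apply: filterS nearD => -[s t]/=; rewrite -/(P s t) E => /duf/dirDP/is_dirD_shift[_ H].
    by apply: is_derive_ext H => s'; rewrite /restr_im E.
  have H2 : {for (0, 0), continuous
      (fun p : R * R => complex.Im (dirD u f (P p.1 p.2)))}.
    exact: (continuous_comp c0 (@Im_continuous _ _)).
  have H3 : is_derive (0 : R) (1 : R) (fun t => complex.Im (f (P 0 t))) (complex.Im l).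
    by apply: is_derive_ext fi => t; rewrite /restr_im E0.
  have := @is_derive_diag R (fun s t => complex.Im (f (P s t)))
    (fun s t => complex.Im (dirD u f (P s t))) _ H1 H2 H3.
  rewrite Z -cImD; apply: is_derive_ext => t.
  by rewrite /restr_im E1.
Qed.

Lemma dirD_comm (D : set 'rV[Cx R]_m) u v f z : open D -> D z ->
  (forall w, D w -> [/\ dir_derivable u f w, dir_derivable v f w,
     dir_derivable v (dirD u f) w & dir_derivable u (dirD v f) w]) ->
  (forall w, D w -> {for w, continuous (dirD v (dirD u f))}) ->
  (forall w, D w -> {for w, continuous (dirD u (dirD v f))}) ->
  dirD v (dirD u f) z = dirD u (dirD v f) z.
Proof.
move=> oD Dz df c1 c2.
have nearD := plane_near u v oD Dz.
have c10 := @plane_comp_continuous D _ z u v c1 Dz.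
have c20 := @plane_comp_continuous D _ z u v c2 Dz.
pose P s t := z + ofreal s *: u + ofreal t *: v.
have E (s t : R) : P s t = z + ofreal t *: v + ofreal s *: u.
  by rewrite /P addrAC.
have Z : P 0 0 = z by rewrite /P !scale0r !addr0.
have duE g s t l : is_dirD u g (P s t) l ->
  is_derive (s : R) (1 : R) (fun s => complex.Re (g (P s t))) (complex.Re l) /\
  is_derive (s : R) (1 : R) (fun s => complex.Im (g (P s t))) (complex.Im l).
  rewrite E => /is_dirD_shift[A B]; split.
    by apply: is_derive_ext A => s'; rewrite /restr_re E.
  by apply: is_derive_ext B => s'; rewrite /restr_im E.
have dvE g s t l : is_dirD v g (P s t) l ->
  is_derive (t : R) (1 : R) (fun t => complex.Re (g (P s t))) (complex.Re l) /\
  is_derive (t : R) (1 : R) (fun t => complex.Im (g (P s t))) (complex.Im l).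
  by move=> /is_dirD_shift[A B]; split; [exact: is_derive_ext A|exact: is_derive_ext B].
have H1 : \forall p \near ((0, 0) : R * R),
    [/\ is_dirD u f (P p.1 p.2) (dirD u f (P p.1 p.2)),
        is_dirD v f (P p.1 p.2) (dirD v f (P p.1 p.2)),
        is_dirD v (dirD u f) (P p.1 p.2) (dirD v (dirD u f) (P p.1 p.2)) &
        is_dirD u (dirD v f) (P p.1 p.2) (dirD u (dirD v f) (P p.1 p.2))].
  apply: filterS nearD => -[s t] /df[d1 d2 d3 d4].
  by split; [exact: dirDP d1|exact: dirDP d2|exact: dirDP d3|exact: dirDP d4].
rewrite -Z; apply: Cx_eq.
- apply: (@mixed_partials_eq R (fun s t => complex.Re (f (P s t)))
    (fun s t => complex.Re (dirD u f (P s t)))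
    (fun s t => complex.Re (dirD v f (P s t)))
    (fun s t => complex.Re (dirD v (dirD u f) (P s t)))
    (fun s t => complex.Re (dirD u (dirD v f) (P s t)))).
  + apply: filterS H1 => -[s t]/= [/duE[h1 _] /dvE[h2 _] /dvE[h3 _] /duE[h4 _]].
    by split; [exact: h1|exact: h2|exact: h3|exact: h4].
  + exact: (continuous_comp c10 (@Re_continuous _ _)).
  + exact: (continuous_comp c20 (@Re_continuous _ _)).
- apply: (@mixed_partials_eq R (fun s t => complex.Im (f (P s t)))
    (fun s t => complex.Im (dirD u f (P s t)))
    (fun s t => complex.Im (dirD v f (P s t)))
    (fun s t => complex.Im (dirD v (dirD u f) (P s t)))
    (fun s t => complex.Im (dirD u (dirD v f) (P s t)))).
  + apply: filterS H1 => -[s t]/= [/duE[_ h1] /dvE[_ h2] /dvE[_ h3] /duE[_ h4]].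
    by split; [exact: h1|exact: h2|exact: h3|exact: h4].
  + exact: (continuous_comp c10 (@Im_continuous _ _)).
  + exact: (continuous_comp c20 (@Im_continuous _ _)).
Qed.

End DirectionalDerivative.

(** * Smooth functions *)

Section Smoothness.
Variables (R : realType) (m : nat).
Implicit Types (f g : 'rV[Cx R]_m -> Cx R) (F : 'rV[Cx R]_m -> R).
Implicit Types (D : set 'rV[Cx R]_m) (z u v : 'rV[Cx R]_m) (k : nat).

Lemma Ck_continuous k D f z : Ck k D f -> D z -> {for z, continuous f}.
Proof. by case: k => [|k] [cf _]; exact: cf. Qed.

Lemma continuous_add f g z : {for z, continuous f} -> {for z, continuous g} ->
  {for z, continuous (fun w => f w + g w)}.
Proof. by move=> cf cg; exact: (@continuousD (Cx R) (Cx R) _ f g z cf cg). Qed.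

Lemma continuous_mul f g z : {for z, continuous f} -> {for z, continuous g} ->
  {for z, continuous (fun w => f w * g w)}.
Proof. by move=> cf cg; exact: (@continuousM (Cx R) _ f g z cf cg). Qed.

Lemma Ck_le k D f : Ck k.+1 D f -> Ck k D f.
Proof.
elim: k f => [|k IH] f [cf df]; split => // j b.
by have [? ?] := df j b; split => //; exact: IH.
Qed.

Lemma continuous_open D f g z : open D -> D z ->
  (forall w, D w -> f w = g w) -> {for z, continuous f} -> {for z, continuous g}.
Proof.
move=> oD Dz fg cf; suff: g w @[w --> z] --> f z by rewrite (fg z Dz).
have nD : \forall w \near z, f w = g w.
  by apply: filterS fg _; apply: open_nbhs_nbhs.
exact: cvg_trans (near_eq_cvg nD) cf.
Qed.

Lemma dir_derivable_open D f g z u : open D -> D z ->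
  (forall w, D w -> f w = g w) -> dir_derivable u f z -> dir_derivable u g z.
Proof.
move=> oD Dz fg /dirDP df; apply: is_dirD_derivable (is_dirD_near _ df).
by apply: filterS (line_near u oD Dz) => t; exact: fg.
Qed.

(** Openness of [D] makes the derivatives at its points depend on the values on
    [D] only. *)
Lemma Ck_eq k D f g : open D -> (forall w, D w -> f w = g w) -> Ck k D f -> Ck k D g.
Proof.
move=> oD; elim: k f g => [|k IH] f g fg [cf df].
  by split=> [z Dz|]; [exact: continuous_open oD Dz fg (cf z Dz)|].
split=> [z Dz|j b]; first exact: continuous_open oD Dz fg (cf z Dz).
have [dd Cd] := df j b; split=> [z Dz|].
  exact: dir_derivable_open oD Dz fg (dd z Dz).
by apply: IH Cd => w Dw; exact: dirD_open oD Dw fg.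
Qed.

Lemma Ck_dirD k D f j b : Ck k.+1 D f -> Ck k D (dirD (rdir R j b) f).
Proof. by move=> [_ /(_ j b)[]]. Qed.

Lemma Ck_derivable k D f z j b : Ck k.+1 D f -> D z -> dir_derivable (rdir R j b) f z.
Proof. by move=> [_ /(_ j b)[+ _]]; apply. Qed.

Lemma Ck_cst k D c : Ck k D (fun=> c).
Proof.
elim: k c => [|k IH] c; first by split=> [z _|//]; exact: cst_continuous.
split=> [z _|j b]; first exact: cst_continuous.
have E : dirD (rdir R j b) (fun=> c) = fun=> 0.
  by apply: funext => z; exact: is_dirDE (is_dirD_cst (rdir R j b) z c).
split=> [z _|]; first exact: is_dirD_derivable (is_dirD_cst (rdir R j b) z c).
by rewrite E; exact: IH.
Qed.

Lemma CkD k D f g : open D -> Ck k D f -> Ck k D g -> Ck k D (fun w => f w + g w).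
Proof.
move=> oD; elim: k f g => [|k IH] f g Cf Cg.
  split=> [z Dz|//].
  by apply: continuous_add;
    [exact: Ck_continuous Cf Dz|exact: Ck_continuous Cg Dz].
split=> [z Dz|].
  by apply: continuous_add;
    [exact: Ck_continuous Cf Dz|exact: Ck_continuous Cg Dz].
have H z j b : D z -> is_dirD (rdir R j b) (fun w => f w + g w) z
    (dirD (rdir R j b) f z + dirD (rdir R j b) g z).
  move=> Dz; apply: is_dirDD; apply: dirDP.
    exact: Ck_derivable Cf Dz.
  exact: Ck_derivable Cg Dz.
move=> j b; split => [z Dz|]; first exact: is_dirD_derivable (H z j b Dz).
apply: (@Ck_eq _ _ (fun w =>
  dirD (rdir R j b) f w + dirD (rdir R j b) g w)) => [//|w Dw|].
  by rewrite (is_dirDE (H w j b Dw)).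
by apply: IH; exact: Ck_dirD.
Qed.

Lemma CkM k D f g : open D -> Ck k D f -> Ck k D g -> Ck k D (fun w => f w * g w).
Proof.
move=> oD; elim: k f g => [|k IH] f g Cf Cg.
  split=> [z Dz|//].
  by apply: continuous_mul;
    [exact: Ck_continuous Cf Dz|exact: Ck_continuous Cg Dz].
split=> [z Dz|].
  by apply: continuous_mul;
    [exact: Ck_continuous Cf Dz|exact: Ck_continuous Cg Dz].
have H z j b : D z -> is_dirD (rdir R j b) (fun w => f w * g w) z
    (dirD (rdir R j b) f z * g z + f z * dirD (rdir R j b) g z).
  move=> Dz; apply: is_dirDM; apply: dirDP.
    exact: Ck_derivable Cf Dz.
  exact: Ck_derivable Cg Dz.
move=> j b; split => [z Dz|]; first exact: is_dirD_derivable (H z j b Dz).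
apply: (@Ck_eq _ _ (fun w =>
  dirD (rdir R j b) f w * g w + f w * dirD (rdir R j b) g w)) => [//|w Dw|].
  by rewrite (is_dirDE (H w j b Dw)).
by apply: CkD => //; apply: IH; do ?exact: Ck_dirD; exact: Ck_le.
Qed.

(** The derivative of 1/F is - F' (1/F)^2, so regularity of order k of 1/F
    gives order k+1. *)
Lemma CkV k D F : open D -> (forall w, D w -> F w != 0) ->
  Ck k D (fun w => ofreal (F w)) -> Ck k D (fun w => ofreal (F w)^-1).
Proof.
move=> oD F0.
have cV l z : D z -> Ck l D (fun w => ofreal (F w)) ->
    {for z, continuous (fun w => ofreal (F w)^-1)}.
  move=> Dz CF.
  rewrite (_ : (fun w => _) = fun w => (ofreal (F w))^-1); last first.
    by apply/funext => w; rewrite ofrealV.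
  apply: (@continuousV (Cx R) _ (fun w => ofreal (F w))).
    by rewrite ofreal_eq0 F0.
  exact: Ck_continuous CF Dz.
elim: k => [|k IH] CF; first by split=> [z Dz|//]; exact: cV Dz CF.
split=> [z Dz|]; first exact: cV Dz CF.
have H z j b : D z -> is_dirD (rdir R j b) (fun w => ofreal (F w)^-1) z
    (- dirD (rdir R j b) (fun w => ofreal (F w)) z / ofreal (F z) ^+ 2).
  move=> Dz; apply: is_dirDV_real; first exact: F0.
  by apply: dirDP; exact: Ck_derivable CF Dz.
move=> j b; split => [z Dz|]; first exact: is_dirD_derivable (H z j b Dz).
have CV := IH (Ck_le CF).
apply: (@Ck_eq _ _ (fun w => - 1 * dirD (rdir R j b) (fun w => ofreal (F w)) w
  * (ofreal (F w)^-1 * ofreal (F w)^-1))) => [//|w Dw|].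
  by rewrite (is_dirDE (H w j b Dw)) ofrealV -expr2 exprVn mulN1r.
apply: CkM => //; last by apply: CkM.
by apply: CkM => //; [exact: Ck_cst|exact: Ck_dirD].
Qed.

Lemma Ck_ln k D F : open D -> (forall w, D w -> 0 < F w) ->
  Ck k D (fun w => ofreal (F w)) -> Ck k D (fun w => ofreal (ln (F w))).
Proof.
move=> oD F0 CF.
have cln z : D z -> {for z, continuous (fun w => ofreal (ln (F w)))}.
  move=> Dz; have cF := Ck_continuous CF Dz.
  have cF' : {for z, continuous F}.
    have H : {for z, continuous (@complex.Re R \o (fun w => ofreal (F w)))}.
      apply: continuous_comp; [exact: cF|exact: Re_continuous].
    exact: H.
  have H : {for z, continuous (@ofreal R \o (@ln R \o F))}.
    apply: continuous_comp; last exact: ofreal_continuous.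
    by apply: continuous_comp; [exact: cF'|apply: continuous_ln; exact: F0].
  exact: H.
case: k CF => [|k] CF; split; [exact: cln|by []|exact: cln|].
have H z j b : D z -> is_dirD (rdir R j b) (fun w => ofreal (ln (F w))) z
    (dirD (rdir R j b) (fun w => ofreal (F w)) z / ofreal (F z)).
  move=> Dz; apply: is_dirD_ln_real; first exact: F0.
  by apply: dirDP; exact: Ck_derivable CF Dz.
move=> j b; split => [z Dz|]; first exact: is_dirD_derivable (H z j b Dz).
apply: (@Ck_eq _ _ (fun w => dirD (rdir R j b) (fun w => ofreal (F w)) w
  * ofreal (F w)^-1)) => [//|w Dw|].
  by rewrite (is_dirDE (H w j b Dw)) ofrealV.
apply: CkM => //; first exact: Ck_dirD.
by apply: CkV => //; [move=> w Dw; rewrite gt_eqF ?F0|exact: Ck_le].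
Qed.

End Smoothness.

(** An affine map sends lines to lines, so composing with it merely changes the
    direction of differentiation. *)
Lemma dirD_comp (R : realType) (m p : nat) (A : 'rV[Cx R]_m -> 'rV[Cx R]_p)
    (f : 'rV[Cx R]_p -> Cx R) u v z :
  (forall t, A (z + ofreal t *: u) = A z + ofreal t *: v) ->
  dirD u (f \o A) z = dirD v f (A z) /\
  (dir_derivable v f (A z) -> dir_derivable u (f \o A) z).
Proof.
move=> Auv; rewrite /dirD /dir_derivable.
have -> : restr_re (f \o A) z u = restr_re f (A z) v.
  by apply/funext => t; rewrite /restr_re/= Auv.
have -> // : restr_im (f \o A) z u = restr_im f (A z) v.
by apply/funext => t; rewrite /restr_im/= Auv.
Qed.

Lemma Ck_comp (R : realType) (m p k : nat) (A : 'rV[Cx R]_m -> 'rV[Cx R]_p)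
    (sg : 'I_m -> 'I_p) (D : set 'rV[Cx R]_m) (D' : set 'rV[Cx R]_p)
    (f : 'rV[Cx R]_p -> Cx R) :
  continuous A -> (forall w, D w -> D' (A w)) ->
  (forall z j b t, A (z + ofreal t *: rdir R j b) =
                   A z + ofreal t *: rdir R (sg j) b) ->
  Ck k D' f -> Ck k D (f \o A).
Proof.
move=> cA DD' Adir; have cfA (h : 'rV[Cx R]_p -> Cx R) :
    (forall w, D' w -> {for w, continuous h}) ->
    forall z, D z -> {for z, continuous (h \o A)}.
  by move=> ch z Dz; apply: continuous_comp; [exact: cA|exact: ch (DD' _ Dz)].
elim: k f => [|k IH] f [cf df]; first by split; [exact: cfA|].
split; first exact: cfA.
move=> j b; have [dd Cd] := df (sg j) b; split.
  move=> z Dz; have [_] := dirD_comp f (Adir z j b); apply; exact: dd (DD' _ Dz).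
have E : dirD (rdir R j b) (f \o A) = dirD (rdir R (sg j) b) f \o A.
  by apply: funext => z; have [->] := dirD_comp f (Adir z j b).
by rewrite E; exact: IH.
Qed.

(** * Wirtinger derivatives *)

Section Wirtinger.
Variables (R : realType) (m : nat).
Implicit Types (f g : 'rV[Cx R]_m -> Cx R) (F : 'rV[Cx R]_m -> R).
Implicit Types (D : set 'rV[Cx R]_m) (z u v : 'rV[Cx R]_m) (s c : Cx R).
Implicit Types (j p q : 'I_m).

(** For s = -i and s = i these are the derivatives of type (1,0) and (0,1) along
    the complex line of [u].  Keeping [s] as a parameter proves each rule for
    both types at once. *)
Definition wirt s u f z : Cx R := (dirD u f z + s * dirD ('i *: u) f z) / 2%:R.

Notation E_ j := (delta_mx 0 j : 'rV[Cx R]_m).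

Definition wirt_derivable u f z :=
  dir_derivable u f z /\ dir_derivable ('i *: u) f z.

Lemma rdir_false j : rdir R j false = E_ j.
Proof. by rewrite /rdir scale1r. Qed.

Lemma rdir_true j : rdir R j true = 'i *: E_ j.
Proof. by []. Qed.

Lemma dzE j f z : dz j f z = wirt (- 'i) (E_ j) f z.
Proof. by rewrite /dz /wirt rdir_false rdir_true mulNr. Qed.

Lemma dzbE j f z : dzb j f z = wirt 'i (E_ j) f z.
Proof. by rewrite /dzb /wirt rdir_false rdir_true. Qed.

Lemma is_dirD_wirt s u f z l l' : is_dirD u f z l -> is_dirD ('i *: u) f z l' ->
  wirt s u f z = (l + s * l') / 2%:R.
Proof. by move=> /is_dirDE E1 /is_dirDE E2; rewrite /wirt E1 E2. Qed.

Lemma wirtM s u f g z : wirt_derivable u f z -> wirt_derivable u g z ->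
  wirt s u (fun w => f w * g w) z = wirt s u f z * g z + f z * wirt s u g z.
Proof.
move=> [/dirDP f1 /dirDP f2] [/dirDP g1 /dirDP g2].
rewrite (is_dirD_wirt s (is_dirDM f1 g1) (is_dirDM f2 g2)) /wirt; ring.
Qed.

Lemma wirtZ s u f z c : wirt_derivable u f z ->
  wirt s u (fun w => c * f w) z = c * wirt s u f z.
Proof.
move=> [/dirDP f1 /dirDP f2].
rewrite (is_dirD_wirt s (is_dirDZ c f1) (is_dirDZ c f2)) /wirt; ring.
Qed.

Lemma wirt_sum (I : finType) s u (f : I -> 'rV[Cx R]_m -> Cx R) z :
  (forall i, wirt_derivable u (f i) z) ->
  wirt s u (fun w => \sum_i f i w) z = \sum_i wirt s u (f i) z.
Proof.
move=> df.
have f1 i : is_dirD u (f i) z (dirD u (f i) z) by apply: dirDP; case: (df i).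
have f2 i : is_dirD ('i *: u) (f i) z (dirD ('i *: u) (f i) z).
  by apply: dirDP; case: (df i).
rewrite (is_dirD_wirt s (is_dirD_sum f1) (is_dirD_sum f2)).
by rewrite mulr_sumr -big_split/= mulr_suml.
Qed.

Lemma wirt_conj s u f z : wirt_derivable u f z ->
  wirt s u (fun w => (f w)^*) z = (wirt s^* u f z)^*.
Proof.
move=> [/dirDP f1 /dirDP f2].
rewrite (is_dirD_wirt s (is_dirD_conj f1) (is_dirD_conj f2)) /wirt.
by rewrite !rmorphM rmorphD rmorphM/= conjCK fmorphV/= rmorph_nat.
Qed.

Lemma wirt_ln s u F z : 0 < F z -> wirt_derivable u (fun w => ofreal (F w)) z ->
  wirt s u (fun w => ofreal (ln (F w))) z =
  wirt s u (fun w => ofreal (F w)) z / ofreal (F z).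
Proof.
move=> F0 [/dirDP f1 /dirDP f2].
rewrite (is_dirD_wirt s (is_dirD_ln_real F0 f1) (is_dirD_ln_real F0 f2)) /wirt.
ring.
Qed.

Lemma wirt_derivableV u F z : F z != 0 ->
  wirt_derivable u (fun w => ofreal (F w)) z ->
  wirt_derivable u (fun w => ofreal (F w)^-1) z.
Proof.
move=> F0 [/dirDP f1 /dirDP f2].
by split; [exact: is_dirD_derivable (is_dirDV_real F0 f1)|
           exact: is_dirD_derivable (is_dirDV_real F0 f2)].
Qed.

Lemma wirtV s u F z : F z != 0 -> wirt_derivable u (fun w => ofreal (F w)) z ->
  wirt s u (fun w => ofreal (F w)^-1) z =
  - wirt s u (fun w => ofreal (F w)) z / ofreal (F z) ^+ 2.
Proof.
move=> F0 [/dirDP f1 /dirDP f2].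
rewrite (is_dirD_wirt s (is_dirDV_real F0 f1) (is_dirDV_real F0 f2)) /wirt.
ring.
Qed.

Lemma wirt_open D s u f g z : open D -> D z -> (forall w, D w -> f w = g w) ->
  wirt s u f z = wirt s u g z.
Proof.
move=> oD Dz fg; rewrite /wirt (dirD_open u oD Dz fg).
by rewrite (dirD_open ('i *: u) oD Dz fg).
Qed.

Lemma smooth_wirt_derivable D f z j : smooth D f -> D z -> wirt_derivable (E_ j) f z.
Proof.
move=> /(_ 1%N) Cf Dz; rewrite /wirt_derivable -rdir_true -rdir_false.
by split; exact: Ck_derivable Cf Dz.
Qed.

Lemma smoothD D f g : open D -> smooth D f -> smooth D g ->
  smooth D (fun w => f w + g w).
Proof. by move=> oD sf sg k; apply: CkD. Qed.

Lemma smoothM D f g : open D -> smooth D f -> smooth D g ->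
  smooth D (fun w => f w * g w).
Proof. by move=> oD sf sg k; apply: CkM. Qed.

Lemma smooth_cst D c : smooth D (fun=> c).
Proof. by move=> k; exact: Ck_cst. Qed.

Lemma smooth_dirD D f j b : smooth D f -> smooth D (dirD (rdir R j b) f).
Proof. by move=> sf k; apply: Ck_dirD (sf k.+1). Qed.

Lemma smooth_wirt D s f j : open D -> smooth D f -> smooth D (wirt s (E_ j) f).
Proof.
move=> oD sf.
rewrite (_ : wirt s (E_ j) f = fun w =>
  (dirD (rdir R j false) f w + s * dirD (rdir R j true) f w) * 2%:R^-1).
  apply: smoothM => //; last exact: smooth_cst.
  apply: smoothD => //; first exact: smooth_dirD.
  by apply: smoothM; [|exact: smooth_cst|exact: smooth_dirD].
by apply/funext => w; rewrite rdir_false rdir_true.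
Qed.

Lemma dirD_wirt s u j f z : dir_derivable u (dirD (E_ j) f) z ->
  dir_derivable u (dirD ('i *: E_ j) f) z ->
  dirD u (wirt s (E_ j) f) z =
  (dirD u (dirD (E_ j) f) z + s * dirD u (dirD ('i *: E_ j) f) z) / 2%:R.
Proof.
move=> /dirDP f1 /dirDP f2.
have := is_dirDZ 2%:R^-1 (is_dirDD f1 (is_dirDZ s f2)).
under eq_fun do rewrite mulrC.
by move=> /is_dirDE ->; rewrite mulrC.
Qed.

Lemma wirt_comm D s t p q f z : open D -> smooth D f -> D z ->
  wirt s (E_ p) (wirt t (E_ q) f) z = wirt t (E_ q) (wirt s (E_ p) f) z.
Proof.
move=> oD sf Dz.
have d1 j b w : D w -> dir_derivable (rdir R j b) f w.
  by move=> Dw; exact: Ck_derivable (sf 1%N) Dw.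
have d2 j b j' b' w : D w -> dir_derivable (rdir R j' b') (dirD (rdir R j b) f) w.
  by move=> Dw; exact: Ck_derivable (smooth_dirD j b sf 1%N) Dw.
have c2 j b j' b' w : D w ->
    {for w, continuous (dirD (rdir R j' b') (dirD (rdir R j b) f))}.
  move=> Dw; exact: Ck_continuous (smooth_dirD j' b' (smooth_dirD j b sf) 0%N) Dw.
have comm j b j' b' : dirD (rdir R j' b') (dirD (rdir R j b) f) z =
    dirD (rdir R j b) (dirD (rdir R j' b') f) z.
  apply: (dirD_comm oD Dz) => w Dw; last 2 first.
  - exact: c2.
  - exact: c2.
  by split; [exact: d1|exact: d1|exact: d2|exact: d2].
have d2' j b j' b' := d2 j b j' b' z Dz.
rewrite [LHS]/wirt [RHS]/wirt !dirD_wirt -?rdir_true -?rdir_false;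
  [|exact: d2'..].
pose dd j b j' b' := dirD (rdir R j' b') (dirD (rdir R j b) f) z.
change (forall j b j' b', dd j b j' b' = dd j' b' j b) in comm.
change ((((dd q false p false + t * dd q true p false) / 2%:R +
     s * ((dd q false p true + t * dd q true p true) / 2%:R)) / 2%:R) =
  (((dd p false q false + s * dd p true q false) / 2%:R +
     t * ((dd p false q true + s * dd p true q true) / 2%:R)) / 2%:R)).
clearbody dd; rewrite (comm q false p false) (comm q true p false).
rewrite (comm q false p true) (comm q true p true); ring.
Qed.

(** Continuity of the partial derivatives makes the derivative linear in the
    direction: the 2m real coordinate directions are added one after the
    other. *)
Lemma is_dirD_expand D f z u : open D -> smooth D f -> D z ->
  is_dirD u f z (\sum_j (ofreal (complex.Re (u 0 j)) * dirD (E_ j) f z +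
                        ofreal (complex.Im (u 0 j)) * dirD ('i *: E_ j) f z)).
Proof.
move=> oD sf Dz.
have span (r : seq ('I_m * bool)) (x : 'I_m * bool -> R) :
    is_dirD (\sum_(i <- r) ofreal (x i) *: rdir R i.1 i.2) f z
            (\sum_(i <- r) ofreal (x i) * dirD (rdir R i.1 i.2) f z).
  elim: r => [|[j b] r IH]; first by rewrite !big_nil; exact: is_dirD0.
  rewrite !big_cons/=.
  have dx w : D w -> is_dirD (ofreal (x (j, b)) *: rdir R j b) f w
      (ofreal (x (j, b)) * dirD (rdir R j b) f w).
    move=> Dw; apply: is_dirD_scale; apply: dirDP.
    exact: Ck_derivable (sf 1%N) Dw.
  rewrite -(is_dirDE (dx z Dz)); apply: (is_dirD_add oD Dz) => // w Dw.
    exact: is_dirD_derivable (dx w Dw).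
  apply: (@continuous_open _ _ D
    (fun w => ofreal (x (j, b)) * dirD (rdir R j b) f w)) => //.
    by move=> w' Dw'; rewrite (is_dirDE (dx w' Dw')).
  apply: continuous_mul; first exact: cst_continuous.
  exact: Ck_continuous (smooth_dirD j b sf 0%N) Dw.
have := span [seq (j, b) | j <- enum 'I_m, b <- [:: false; true]]
  (fun i => if i.2 then complex.Im (u 0 i.1) else complex.Re (u 0 i.1)).
have sumE (V : nmodType) (h : 'I_m * bool -> V) :
    \sum_(i <- [seq (j, b) | j <- enum 'I_m, b <- [:: false; true]]) h i =
    \sum_j (h (j, false) + h (j, true)).
  rewrite big_allpairs big_enum/=; apply: eq_bigr => j _.
  by rewrite !big_cons big_nil addr0.
rewrite !sumE/=.
have -> : \sum_j (ofreal (complex.Re (u 0 j)) *: rdir R j false +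
                  ofreal (complex.Im (u 0 j)) *: rdir R j true) = u.
  rewrite [RHS]row_sum_delta; apply: eq_bigr => j _.
  rewrite rdir_false rdir_true scalerA -scalerDl; congr (_ *: _).
  by rewrite [RHS]complexE mulrC.
by move=> /is_dirD_eq; apply; apply: eq_bigr => j _; rewrite rdir_false.
Qed.

Lemma smooth_wirt_derivable_dir D f z u : open D -> smooth D f -> D z ->
  wirt_derivable u f z.
Proof.
by move=> oD sf Dz; split; exact: is_dirD_derivable (is_dirD_expand _ oD sf Dz).
Qed.

(** Derivatives of type (1,0) are complex linear in the direction and those of
    type (0,1) antilinear; this is what brings in the factors c and its
    conjugate under a rescaling of the fibers. *)
Lemma dz_expand D f z u : open D -> smooth D f -> D z ->
  wirt (- 'i) u f z = \sum_j u 0 j * dz j f z.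
Proof.
move=> oD sf Dz; rewrite /wirt !(is_dirDE (is_dirD_expand _ oD sf Dz)).
rewrite mulr_sumr -big_split/=.
rewrite mulr_suml; apply: eq_bigr => j _; rewrite dzE /wirt mxE.
set a := dirD _ _ _; set b := dirD _ _ _.
have i2 : 'i * 'i = -1 :> Cx R by rewrite -expr2 sqrCi.
have -> : complex.Re ('i * u 0 j) = - complex.Im (u 0 j).
  by case: (u 0 j) => ? ?; rewrite cReM/=; ring.
have -> : complex.Im ('i * u 0 j) = complex.Re (u 0 j).
  by case: (u 0 j) => ? ?; rewrite cImM/=; ring.
rewrite {5}[u 0 j]complexE ofrealN -/(ofreal _) -/(ofreal _) complexiE mulrA.
congr (_ / _); ring: i2.
Qed.

Lemma dzb_expand D f z u : open D -> smooth D f -> D z ->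
  wirt 'i u f z = \sum_j (u 0 j)^* * dzb j f z.
Proof.
move=> oD sf Dz; rewrite /wirt !(is_dirDE (is_dirD_expand _ oD sf Dz)).
rewrite mulr_sumr -big_split/=.
rewrite mulr_suml; apply: eq_bigr => j _; rewrite dzbE /wirt mxE.
set a := dirD _ _ _; set b := dirD _ _ _.
have i2 : 'i * 'i = -1 :> Cx R by rewrite -expr2 sqrCi.
have -> : complex.Re ('i * u 0 j) = - complex.Im (u 0 j).
  by case: (u 0 j) => ? ?; rewrite cReM/=; ring.
have -> : complex.Im ('i * u 0 j) = complex.Re (u 0 j).
  by case: (u 0 j) => ? ?; rewrite cImM/=; ring.
have -> : (u 0 j)^* = ofreal (complex.Re (u 0 j)) - 'i * ofreal (complex.Im (u 0 j)).
  by apply: Cx_eq; case: (u 0 j) => ? ?; rewrite ?cReD ?cImD ?cRe_conj ?cIm_conj/=; ring.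
rewrite ofrealN mulrA.
congr (_ / _); ring: i2.
Qed.

Lemma dz_scale D f z j c : open D -> smooth D f -> D z ->
  wirt (- 'i) (c *: E_ j) f z = c * dz j f z.
Proof.
move=> oD sf Dz; rewrite (dz_expand _ oD sf Dz) (bigD1 j)//= big1 => [|i ij].
  by rewrite addr0 !mxE !eqxx mulr1.
by rewrite !mxE (negbTE ij) andbF mulr0 mul0r.
Qed.

Lemma dzb_scale D f z j c : open D -> smooth D f -> D z ->
  wirt 'i (c *: E_ j) f z = c^* * dzb j f z.
Proof.
move=> oD sf Dz; rewrite (dzb_expand _ oD sf Dz) (bigD1 j)//= big1 => [|i ij].
  by rewrite addr0 !mxE !eqxx mulr1.
by rewrite !mxE (negbTE ij) andbF mulr0 rmorph0 mul0r.
Qed.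

Lemma wirt_add_cst s u f z c : wirt_derivable u f z ->
  wirt s u (fun w => f w + c) z = wirt s u f z.
Proof.
move=> [/dirDP f1 /dirDP f2].
rewrite (is_dirD_wirt s (is_dirDD f1 (is_dirD_cst _ _ _))
  (is_dirDD f2 (is_dirD_cst _ _ _))) /wirt !addr0//.
Qed.

End Wirtinger.

(** * Linear algebra of Levi forms *)

(** A projective version of the Schur complement.  With H the Levi form of a
    function of value g in the fiber directions, p, q and s its mixed and base
    parts, and zt, zb the Euler vector and its conjugate, the left-hand side is
    the Schur complement of the Levi form of the logarithm, restricted to the
    directions B transversal to the Euler vector.

    Decompose H^-1 q as B' y + t zb.  The matrix H/g - H zb zt H / g^2 kills zb
    because zt H zb = g; hence the column B(q/g - ...) equals A y, its image
    under A^-1 is y, and the remaining identity is between scalars. *)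
Lemma schur_projective (K : fieldType) (r' r : nat) (H : 'M[K]_r)
    (zt p : 'rV[K]_r) (zb q : 'cV[K]_r) (s : 'M[K]_1) (g : K)
    (B : 'M[K]_(r', r)) (B' : 'M[K]_(r, r')) (A : 'M[K]_r') :
  B *m (g^-1 *: H - g ^- 2 *: (H *m zb *m (zt *m H))) *m B' = A ->
  H \in unitmx -> zt *m H *m zb = g%:M -> g != 0 ->
  (forall x : 'cV[K]_r, exists y t, x = B' *m y + t *: zb) ->
  A \in unitmx ->
  (g^-1 *: s - g ^- 2 *: (p *m zb *m (zt *m q)))
  - (g^-1 *: p - g ^- 2 *: (p *m zb *m (zt *m H))) *m B' *m invmx A
    *m (B *m (g^-1 *: q - g ^- 2 *: (H *m zb *m (zt *m q))))
  = g^-1 *: (s - p *m invmx H *m q).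
Proof.
move=> AE Hu Hg g0 span Au.
have [y [t xE]] := span (invmx H *m q).
have [x' x'E] : exists x', B' *m y = x' by exists (B' *m y).
rewrite x'E in xE.
have qE : q = H *m x' + t *: (H *m zb).
  by rewrite scalemxAr -mulmxDr -xE mulKVmx.
have [al alE] : exists al, p *m zb = al%:M by exists ((p *m zb) 0 0); exact: mx11_scalar.
have [be beE] : exists be, p *m x' = be%:M by exists ((p *m x') 0 0); exact: mx11_scalar.
have [ga gaE] : exists ga, zt *m H *m x' = ga%:M.
  by exists ((zt *m H *m x') 0 0); exact: mx11_scalar.
have ztq : zt *m q = (ga + t * g)%:M.
  by rewrite qE mulmxDr -scalemxAr !mulmxA Hg gaE scale_scalar_mx -raddfD.
have BqE : B *m (g^-1 *: q - g ^- 2 *: (H *m zb *m (zt *m q))) = A *m y.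
  rewrite -AE -[RHS]mulmxA x'E -[RHS]mulmxA; congr (_ *m _).
  rewrite mulmxBl -!scalemxAl -[_ *m (_ *m _) *m _]mulmxA gaE !mul_mx_scalar.
  by rewrite ztq mul_mx_scalar qE; apply/matrixP => i j; rewrite !mxE; field.
rewrite BqE -[_ *m B' *m invmx A *m _]mulmxA mulKmx// -[_ *m B' *m y]mulmxA x'E.
have -> : p *m invmx H *m q = (be + t * al)%:M.
  by rewrite -mulmxA xE mulmxDr -scalemxAr alE beE scale_scalar_mx -raddfD.
rewrite mulmxBl -!scalemxAl -[p *m zb *m _ *m x']mulmxA gaE alE beE ztq.
rewrite -!scalar_mxM; apply/matrixP => i j; rewrite !mxE.
by case: eqP => _; rewrite ?mulr1n ?mulr0n; field.
Qed.

Lemma mulmx3E (K : pzSemiRingType) m1 m2 m3 m4 (u : 'M[K]_(m1, m2))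
    (X : 'M[K]_(m2, m3)) (v : 'M[K]_(m3, m4)) i j :
  (u *m X *m v) i j = \sum_a \sum_b u i b * X b a * v a j.
Proof.
by rewrite mxE; apply: eq_bigr => a _; rewrite mxE mulr_suml.
Qed.

(** Contracting the curvature with the Euler vector contracts each of the two
    factors of its quadratic part separately. *)
Lemma sum_contraction (K : comPzRingType) (r : nat) (S P Q Hi : 'I_r -> 'I_r -> K)
    (a b p q : 'I_r -> K) (s : K) :
  \sum_i \sum_j S i j * a i * b j = s ->
  (forall l, \sum_i a i * P i l = p l) -> (forall k, \sum_j b j * Q k j = q k) ->
  \sum_i \sum_j (- S i j + \sum_k \sum_l Hi l k * P i l * Q k j) * a i * b j =
  - (s - \sum_k \sum_l p l * Hi l k * q k).
Proof.
move=> <- Pp Qq; rewrite opprB addrC.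
have -> : \sum_k \sum_l p l * Hi l k * q k =
   \sum_i \sum_j (\sum_k \sum_l Hi l k * P i l * Q k j) * a i * b j.
  under eq_bigr do under eq_bigr do rewrite -Pp -Qq.
  under [RHS]eq_bigr do under eq_bigr do rewrite !mulr_suml.
  under [RHS]eq_bigr do rewrite exchange_big/=.
  rewrite [RHS]exchange_big/=; apply: eq_bigr => k _.
  under [RHS]eq_bigr do under eq_bigr do rewrite !mulr_suml.
  under [RHS]eq_bigr do rewrite exchange_big/=.
  rewrite [RHS]exchange_big/=; apply: eq_bigr => l _.
  rewrite !mulr_suml; apply: eq_bigr => i _.
  by rewrite mulr_sumr; apply: eq_bigr => j _; ring.
rewrite -sumrN -big_split; apply: eq_bigr => i _.
rewrite -sumrN -big_split; apply: eq_bigr => j _.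
by rewrite /= !mulrDl !mulNr.
Qed.

Section Hermitian.
Variable R : realType.
Implicit Types (r : nat).

Definition herm r (H : 'M[Cx R]_r) (u v : 'rV[Cx R]_r) : Cx R :=
  \sum_i \sum_j H i j * u 0 i * (v 0 j)^*.

Lemma posdef_unitmx r (H : 'M[Cx R]_r) : posdef H -> H \in unitmx.
Proof.
move=> pH; rewrite unitmxE unitfE; apply/det0P => -[v v0 vH].
have := pH v v0; rewrite exchange_big big1 ?ltxx//= => j _.
have := congr1 (fun A : 'rV_r => A 0 j * (v 0 j)^*) vH.
rewrite /= !mxE mul0r mulr_suml => E; rewrite -[RHS]E; apply: eq_bigr => i _.
by rewrite [v 0 i * _]mulrC.
Qed.

Lemma hermE r (H : 'M[Cx R]_r) u v :
  herm H u v = (u *m H *m (map_mx Num.conj v)^T) 0 0.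
Proof.
rewrite [RHS]mxE [LHS]exchange_big /=; apply: eq_bigr => j _.
by rewrite !mxE mulr_suml; apply: eq_bigr => i _; rewrite [u 0 i * _]mulrC.
Qed.

Lemma herm_sub r (H : 'M[Cx R]_r) u v a :
  herm H (u - a *: v) (u - a *: v) =
  herm H u u - a^* * herm H u v - a * herm H v u + a * a^* * herm H v v.
Proof.
rewrite /herm !mulr_sumr -!sumrN -!big_split; apply: eq_bigr => i _.
rewrite !mulr_sumr -!sumrN -!big_split; apply: eq_bigr => j _.
by rewrite /= !mxE rmorphD rmorphN rmorphM /=; ring.
Qed.

(** Strict Cauchy-Schwarz: the expression is the square norm of the component of
    [u] orthogonal to [z], divided by the square norm of [z]. *)
Lemma log_levi_gt0 r (H : 'M[Cx R]_r) (u z : 'rV[Cx R]_r) :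
  posdef H -> (forall a, u != a *: z) -> z != 0 ->
  herm H z u = (herm H u z)^* ->
  0 < herm H u u / herm H z z - herm H u z * herm H z u / herm H z z ^+ 2.
Proof.
move=> pH uz z0 hzu.
have g0 : 0 < herm H z z := pH z z0.
have gR : (herm H z z)^* = herm H z z by apply: conj_Creal; exact: gtr0_real.
have := pH (u - (herm H u z / herm H z z) *: z); rewrite subr_eq0 => /(_ (uz _)).
rewrite -/(herm _ _ _) herm_sub rmorphM fmorphV /= gR -hzu.
set g := herm H z z; set a := herm H u u; set b := herm H u z; set c := herm H z u.
have gn0 : g != 0 by rewrite gt_eqF.
have -> : a - c / g * b - b / g * c + b / g * (c / g) * g = a - b * c / g by field.
move=> H0; have -> : a / g - b * c / g ^+ 2 = (a - b * c / g) / g by field.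
by rewrite divr_gt0.
Qed.

End Hermitian.

(** * Euler identities for a homogeneous potential *)

Section Homogeneous.
Variables (R : realType) (n r : nat).

Definition off_zero (Z : set 'rV[Cx R]_n) : set 'rV[Cx R]_(n + r) :=
  [set w | Z (lsubmx w) /\ rsubmx w != 0].

(** What a Finsler metric becomes in coordinates (z, zeta) on the total space. *)
Record homogeneous_potential (Z : set 'rV[Cx R]_n)
    (F : 'rV[Cx R]_(n + r) -> R) : Prop := HomogeneousPotential {
  potential_open : open (off_zero Z);
  potential_gt0 : forall w, off_zero Z w -> 0 < F w;
  potential_smooth : smooth (off_zero Z) (fun w => ofreal (F w));
  potential_homog : forall w a,
    F (row_mx (lsubmx w) (a *: rsubmx w)) = normsq a * F w }.

Variables (Z : set 'rV[Cx R]_n) (F : 'rV[Cx R]_(n + r) -> R).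
Hypothesis potF : homogeneous_potential Z F.

Let open_off_zero := potential_open potF.
Let F_gt0 := potential_gt0 potF.
Let F_smooth := potential_smooth potF.
Let F_homog := potential_homog potF.

Local Notation D := (off_zero Z).
Local Notation f := (fun w => ofreal (F w)).
Local Notation E_ j := (delta_mx 0 j : 'rV[Cx R]_(n + r)).
Implicit Types (w : 'rV[Cx R]_(n + r)) (p q : 'I_(n + r)).

Lemma ofreal_conj (x : R) : (ofreal x)^* = ofreal x.
Proof. by apply: Cx_eq; rewrite ?cRe_conj ?cIm_conj/= ?oppr0. Qed.

Lemma smooth_dz p (h : 'rV[Cx R]_(n + r) -> Cx R) : smooth D h -> smooth D (dz p h).
Proof.
move=> sh; rewrite (_ : dz p h = wirt (- 'i) (E_ p) h); first exact: smooth_wirt.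
by apply: funext => w; rewrite dzE.
Qed.

Lemma smooth_dzb p (h : 'rV[Cx R]_(n + r) -> Cx R) : smooth D h -> smooth D (dzb p h).
Proof.
move=> sh; rewrite (_ : dzb p h = wirt 'i (E_ p) h); first exact: smooth_wirt.
by apply: funext => w; rewrite dzbE.
Qed.

Lemma dz_comm p q (h : 'rV[Cx R]_(n + r) -> Cx R) w : smooth D h -> D w ->
  dzb p (dz q h) w = dz q (dzb p h) w.
Proof.
move=> sh Dw.
have -> : dz q h = wirt (- 'i) (E_ q) h by apply: funext => w'; rewrite dzE.
have -> : dzb p h = wirt 'i (E_ p) h by apply: funext => w'; rewrite dzbE.
by rewrite dzE dzbE; exact: wirt_comm open_off_zero sh Dw.
Qed.

Lemma conj_dz p w : D w -> (dz p f w)^* = dzb p f w.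
Proof.
move=> Dw; rewrite dzE dzbE.
have := wirt_conj 'i (smooth_wirt_derivable p F_smooth Dw).
rewrite conjCi => <-.
by under eq_fun do rewrite ofreal_conj.
Qed.

(** On the complex line through zeta, F(z, (1 + t) zeta) = (1 + t)^2 F and
    F(z, (1 + i t) zeta) = (1 + t^2) F, with derivatives 2 F and 0 at t = 0. *)
Lemma wirt_radial w : D w -> wirt (- 'i) (row_mx 0 (rsubmx w)) f w = f w.
Proof.
move=> Dw; set u := row_mx _ _.
have line (c : Cx R) t : F (w + ofreal t *: (c *: u)) =
    normsq (1 + ofreal t * c) * F w.
  rewrite -F_homog /u; congr (F _).
  have [x [y ->]] : exists x y, w = row_mx x y.
    by exists (lsubmx w), (rsubmx w); rewrite hsubmxK.
  rewrite row_mxKl row_mxKr !scale_row_mx add_row_mx !scaler0 addr0 scalerA.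
  by rewrite -[y in y + _]scale1r -scalerDl.
have H (c : Cx R) (l : R) : is_derive (0 : R) (1 : R)
    (fun t => normsq (1 + ofreal t * c)) l ->
    is_dirD (c *: u) f w (ofreal (l * F w)).
  move=> Hl; apply: real_is_dirD.
  have Hc : is_derive (0 : R) (1 : R) (fun _ : R => F w) 0 by exact: is_derive_cst.
  have := is_deriveM Hl Hc; rewrite scaler0 add0r [_ *: _]mulrC.
  by apply: is_derive_ext => t; rewrite line.
have H1 : is_derive (0 : R) (1 : R) (fun t => normsq (1 + ofreal t * (1 : Cx R))) (2 : R).
  have Hd : is_derive (0 : R) (1 : R) (fun t : R => (1 + t) ) (1 : R).
    have := is_deriveD (is_derive_cst (1 : R) (0 : R) (1 : R))
      (is_derive_id (0 : R) (1 : R)).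
    by rewrite add0r.
  have := is_deriveM Hd Hd; rewrite addr0 scale1r -[1 + 1]/(2 : R).
  by apply: is_derive_ext => t; rewrite mulr1 /normsq/= !addr0 expr0n/= addr0 expr2.
have H2 : is_derive (0 : R) (1 : R) (fun t => normsq (1 + ofreal t * ('i : Cx R))) (0 : R).
  have Hd := is_derive_id (0 : R) (1 : R).
  have := is_deriveD (is_derive_cst (1 : R) (0 : R) (1 : R)) (is_deriveM Hd Hd).
  rewrite add0r scale0r addr0.
  apply: is_derive_ext => t.
  by rewrite /normsq/= !mul0r !mulr0 !mulr1 !subr0 !addr0 add0r expr1n expr2.
have E1 := H _ _ H1; rewrite scale1r in E1.
rewrite (is_dirD_wirt _ E1 (H _ _ H2)) mul0r mulr0 addr0 ofrealM.
rewrite (_ : ofreal 2 = 2%:R); last exact: rmorph_nat.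
by rewrite mulrC mulKf// pnatr_eq0.
Qed.

Lemma euler w : D w -> \sum_i rsubmx w 0 i * dz (rshift n i) f w = f w.
Proof.
move=> Dw; rewrite -[RHS](wirt_radial Dw).
rewrite (dz_expand _ open_off_zero F_smooth Dw) big_split_ord/= [X in X + _]big1 ?add0r.
  by apply: eq_bigr => i _; rewrite row_mxEr.
by move=> i _; rewrite row_mxEl mxE mul0r.
Qed.

Lemma euler_conj w : D w -> \sum_j (rsubmx w 0 j)^* * dzb (rshift n j) f w = f w.
Proof.
move=> Dw; rewrite -[RHS]ofreal_conj -(euler Dw) rmorph_sum.
by apply: eq_bigr => i _; rewrite rmorphM -(conj_dz _ Dw).
Qed.

Lemma is_dirD_coord (u : 'rV[Cx R]_(n + r)) w (i : 'I_r) :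
  is_dirD u (fun w => rsubmx w 0 i) w (rsubmx u 0 i).
Proof.
have line t : rsubmx (w + ofreal t *: u) 0 i = rsubmx w 0 i + ofreal t * rsubmx u 0 i.
  by rewrite !mxE.
have Hd (x y : R) : is_derive (0 : R) (1 : R) (fun t => x + t * y) y.
  have := is_deriveD (is_derive_cst x (0 : R) (1 : R)) (is_derive_comp_scale y
    (is_derive_id (0 : R) (1 : R))).
  by rewrite add0r mulr1.
split.
- by apply: is_derive_ext (Hd (complex.Re (rsubmx w 0 i)) _) => t;
    rewrite /restr_re line cReD cReM Re_ofreal Im_ofreal mul0r subr0.
- by apply: is_derive_ext (Hd (complex.Im (rsubmx w 0 i)) _) => t;
    rewrite /restr_im line cImD cImM Re_ofreal Im_ofreal mul0r addr0.
Qed.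

Lemma coord_derivable u w i : wirt_derivable u (fun w => rsubmx w 0 i) w.
Proof.
by split; exact: is_dirD_derivable (is_dirD_coord _ _ _).
Qed.

Lemma conj_coord_derivable u w i : wirt_derivable u (fun w => (rsubmx w 0 i)^*) w.
Proof.
by split; exact: is_dirD_derivable (is_dirD_conj (is_dirD_coord _ _ _)).
Qed.

Lemma dzb_coord p w i : wirt 'i (E_ p) (fun w => rsubmx w 0 i) w = 0.
Proof.
rewrite (is_dirD_wirt _ (is_dirD_coord _ _ _) (is_dirD_coord _ _ _)) !mxE.
by rewrite mulrA -expr2 sqrCi mulN1r subrr mul0r.
Qed.

Lemma dz_conj_coord p w i : wirt (- 'i) (E_ p) (fun w => (rsubmx w 0 i)^*) w = 0.
Proof.
rewrite wirt_conj; last exact: coord_derivable.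
by rewrite rmorphN/= conjCi opprK dzb_coord rmorph0.
Qed.

(** Differentiate Euler's identity for the antiholomorphic derivatives: the
    coefficients, conjugates of coordinates, are annihilated. *)
Lemma euler_dz p w : D w ->
  \sum_j (rsubmx w 0 j)^* * dz p (dzb (rshift n j) f) w = dz p f w.
Proof.
move=> Dw; rewrite [RHS]dzE.
rewrite -(wirt_open (- 'i) (E_ p) open_off_zero Dw euler_conj).
have df j : wirt_derivable (E_ p) (dzb (rshift n j) f) w.
  exact: smooth_wirt_derivable (smooth_dzb _ F_smooth) Dw.
rewrite wirt_sum => [|j]; last first.
  have [c1 c2] := conj_coord_derivable (E_ p) w j.
  have [d1 d2] := df j.
  by split; [exact: is_dirD_derivable (is_dirDM (dirDP c1) (dirDP d1))|
             exact: is_dirD_derivable (is_dirDM (dirDP c2) (dirDP d2))].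
apply: eq_bigr => j _.
rewrite wirtM; [|exact: conj_coord_derivable|exact: df].
by rewrite dz_conj_coord mul0r add0r dzE.
Qed.

(** The conjugate argument yields the two derivatives in the other order, hence
    the final exchange. *)
Lemma euler_dzb q w : D w ->
  \sum_i rsubmx w 0 i * dz (rshift n i) (dzb q f) w = dzb q f w.
Proof.
move=> Dw; rewrite [RHS]dzbE.
rewrite -(wirt_open 'i (E_ q) open_off_zero Dw euler).
have df j : wirt_derivable (E_ q) (dz (rshift n j) f) w.
  exact: smooth_wirt_derivable (smooth_dz _ F_smooth) Dw.
rewrite wirt_sum => [|j]; last first.
  have [c1 c2] := coord_derivable (E_ q) w j.
  have [d1 d2] := df j.
  by split; [exact: is_dirD_derivable (is_dirDM (dirDP c1) (dirDP d1))|
             exact: is_dirD_derivable (is_dirDM (dirDP c2) (dirDP d2))].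
apply: eq_bigr => j _.
rewrite wirtM; [|exact: coord_derivable|exact: df].
by rewrite dzb_coord mul0r add0r -dzbE dz_comm.
Qed.

(** A derivative in a base direction only sees the slice on which zeta is
    constant.  There the coefficients zeta^i are constants, so contraction with
    zeta commutes with base derivatives. *)
Lemma wirt_slice s (al : 'I_n) (h1 h2 : 'rV[Cx R]_(n + r) -> Cx R) w : D w ->
  (forall w', D w' -> rsubmx w' = rsubmx w -> h1 w' = h2 w') ->
  wirt s (E_ (lshift r al)) h1 w = wirt s (E_ (lshift r al)) h2 w.
Proof.
move=> Dw h12.
have slice (u : 'rV[Cx R]_(n + r)) : rsubmx u = 0 -> dirD u h1 w = dirD u h2 w.
  move=> u0; apply: dirD_near.
  apply: filterS (line_near u open_off_zero Dw) => t Dt; apply: h12 => //.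
  apply/rowP => j; have := congr1 (fun v : 'rV_r => v 0 j) u0.
  by rewrite !mxE => ->; rewrite mulr0 addr0.
have E0 (c : Cx R) : rsubmx (c *: E_ (lshift r al)) = 0.
  by apply/rowP => j; rewrite !mxE eq_rlshift andbF mulr0.
by rewrite /wirt slice ?slice// -[E_ _]scale1r.
Qed.

Definition levi w : 'M[Cx R]_r :=
  \matrix_(i, j) dz (rshift n i) (dzb (rshift n j) f) w.

Local Notation H_ i j := (dz (rshift n i) (dzb (rshift n j) f)).

Lemma smooth_H i j : smooth D (H_ i j).
Proof. by apply: smooth_dz; apply: smooth_dzb. Qed.

Lemma wirt_lin_sum (I : finType) s u (c : I -> Cx R)
    (h : I -> 'rV[Cx R]_(n + r) -> Cx R) w :
  (forall i, wirt_derivable u (h i) w) ->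
  wirt s u (fun w' => \sum_i c i * h i w') w = \sum_i c i * wirt s u (h i) w.
Proof.
move=> dh; rewrite wirt_sum; first by apply: eq_bigr => i _; rewrite wirtZ.
move=> i; have [d1 d2] := dh i.
by split; [exact: is_dirD_derivable (is_dirDZ _ (dirDP d1))|
           exact: is_dirD_derivable (is_dirDZ _ (dirDP d2))].
Qed.

Lemma dz_levi al j w : D w ->
  \sum_i rsubmx w 0 i * dz (lshift r al) (H_ i j) w =
  dz (lshift r al) (dzb (rshift n j) f) w.
Proof.
move=> Dw; rewrite [RHS]dzE.
rewrite -(@wirt_slice (- 'i) al (fun w' => \sum_i rsubmx w 0 i * H_ i j w') _ w Dw).
  rewrite wirt_lin_sum; first by apply: eq_bigr => i _; rewrite dzE.
  by move=> i; exact: smooth_wirt_derivable (smooth_H i j) Dw.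
by move=> w' Dw' <-; exact: euler_dzb.
Qed.

Lemma dzb_levi be i w : D w ->
  \sum_j (rsubmx w 0 j)^* * dzb (lshift r be) (H_ i j) w =
  dz (rshift n i) (dzb (lshift r be) f) w.
Proof.
move=> Dw; rewrite -dz_comm// [RHS]dzbE.
rewrite -(@wirt_slice 'i be (fun w' => \sum_j (rsubmx w 0 j)^* * H_ i j w') _ w Dw).
  rewrite wirt_lin_sum; first by apply: eq_bigr => j _; rewrite dzbE.
  by move=> j; exact: smooth_wirt_derivable (smooth_H i j) Dw.
by move=> w' Dw' <-; exact: euler_dz.
Qed.

Lemma dz_dzb_levi al be w : D w ->
  \sum_i \sum_j dz (lshift r al) (dzb (lshift r be) (H_ i j)) w
    * rsubmx w 0 i * (rsubmx w 0 j)^* =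
  dz (lshift r al) (dzb (lshift r be) f) w.
Proof.
move=> Dw.
rewrite [RHS]dzE -(@wirt_slice (- 'i) al
  (fun w' => \sum_(ij : 'I_r * 'I_r) rsubmx w 0 ij.1 * (rsubmx w 0 ij.2)^*
      * dzb (lshift r be) (H_ ij.1 ij.2) w') _ w Dw).
  rewrite wirt_lin_sum.
    by rewrite pair_bigA/=; apply: eq_bigr => ij _; rewrite dzE -mulrA mulrC.
  move=> ij; exact: smooth_wirt_derivable (smooth_dzb _ (smooth_H _ _)) Dw.
move=> w' Dw' Ew; rewrite [RHS]dzbE -Ew.
rewrite -(@wirt_slice 'i be
  (fun w1 => \sum_(ij : 'I_r * 'I_r) rsubmx w' 0 ij.1 * (rsubmx w' 0 ij.2)^*
      * H_ ij.1 ij.2 w1) _ w' Dw').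
  rewrite wirt_lin_sum; first by apply: eq_bigr => ij _; rewrite dzbE.
  by move=> ij; exact: smooth_wirt_derivable (smooth_H _ _) Dw'.
move=> w1 Dw1 <-; rewrite -[RHS]euler_conj//.
rewrite -(pair_bigA _ (fun i j => rsubmx w1 0 i * (rsubmx w1 0 j)^* * H_ i j w1))/=.
rewrite exchange_big/=; apply: eq_bigr => j _.
rewrite -euler_dzb// mulr_sumr; apply: eq_bigr => i _.
by rewrite mulrA [_^* * _]mulrC.
Qed.

(** Contracted with the Euler vector, the curvature K is minus the Schur
    complement of the fiber block in the full Levi form of F. *)
Lemma curvature_contraction al be w : D w ->
  \sum_i \sum_j
    (- dz (lshift r al) (dzb (lshift r be) (H_ i j)) w +
     \sum_k \sum_l invmx (levi w) l k * dz (lshift r al) (H_ i l) w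
       * dzb (lshift r be) (H_ k j) w)
    * rsubmx w 0 i * (rsubmx w 0 j)^* =
  - (dz (lshift r al) (dzb (lshift r be) f) w -
     \sum_k \sum_l dz (lshift r al) (dzb (rshift n l) f) w * invmx (levi w) l k
       * dz (rshift n k) (dzb (lshift r be) f) w).
Proof.
move=> Dw.
apply: (@sum_contraction (Cx R) r
  (fun i j => dz (lshift r al) (dzb (lshift r be) (H_ i j)) w)
  (fun i l => dz (lshift r al) (H_ i l) w)
  (fun k j => dzb (lshift r be) (H_ k j) w)
  (fun l k => invmx (levi w) l k)
  (fun i => rsubmx w 0 i) (fun j => (rsubmx w 0 j)^*)
  (fun l => dz (lshift r al) (dzb (rshift n l) f) w)
  (fun k => dz (rshift n k) (dzb (lshift r be) f) w)).
- exact: dz_dzb_levi.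
- by move=> l; exact: dz_levi.
- by move=> k; exact: dzb_levi.
Qed.

Lemma log_levi p q w : D w ->
  dz p (dzb q (fun w => ofreal (ln (F w)))) w =
  dz p (dzb q f) w / f w - dz p f w * dzb q f w / f w ^+ 2.
Proof.
move=> Dw.
have E w' : D w' -> dzb q (fun w => ofreal (ln (F w))) w' = dzb q f w' * ofreal (F w')^-1.
  move=> Dw'; rewrite !dzbE wirt_ln ?ofrealV//; first exact: F_gt0.
  exact: smooth_wirt_derivable F_smooth Dw'.
rewrite dzE (wirt_open _ _ open_off_zero Dw E).
have F0 : F w != 0 by rewrite gt_eqF ?F_gt0.
have df := smooth_wirt_derivable p F_smooth Dw.
rewrite wirtM; last 2 first.
- exact: smooth_wirt_derivable (smooth_dzb _ F_smooth) Dw.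
- exact: wirt_derivableV F0 df.
rewrite wirtV// ofrealV -!dzE !mulNr mulrN; congr (_ - _).
by rewrite mulrA [dzb _ _ _ * _]mulrC.
Qed.

Lemma smooth_log : smooth D (fun w => ofreal (ln (F w))).
Proof. by move=> k; apply: Ck_ln => //; exact: F_smooth. Qed.

End Homogeneous.

(** * The Levi form of the logarithm *)

Section LogPotential.
Variables (R : realType) (n r : nat).
Variables (Z : set 'rV[Cx R]_n) (F : 'rV[Cx R]_(n + r) -> R).
Hypothesis potF : homogeneous_potential Z F.

Local Notation D := (off_zero Z).
Local Notation f := (fun w => ofreal (F w)).
Local Notation L := (fun w => ofreal (ln (F w))).
Implicit Types (w : 'rV[Cx R]_(n + r)) (p q : 'I_(n + r)).
Implicit Types (k : 'I_r) (c : Cx R).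

Local Notation zt w := (rsubmx w).
Local Notation zb w := (map_mx Num.conj (rsubmx w))^T.
Local Notation row_ p w := (\row_l dz p (dzb (rshift n l) f) w : 'rV[Cx R]_r).
Local Notation col_ q w := (\col_l dz (rshift n l) (dzb q f) w : 'cV[Cx R]_r).

Lemma row_zb p w : D w -> row_ p w *m zb w = (dz p f w)%:M.
Proof.
move=> Dw; apply/matrixP => i j; rewrite !ord1 !mxE eqxx mulr1n -(euler_dz potF p Dw).
by apply: eq_bigr => l _; rewrite !mxE mulrC.
Qed.

Lemma zt_col q w : D w -> zt w *m col_ q w = (dzb q f w)%:M.
Proof.
move=> Dw; apply/matrixP => i j; rewrite !ord1 !mxE eqxx mulr1n -(euler_dzb potF q Dw).
by apply: eq_bigr => l _; rewrite !mxE.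
Qed.

Lemma levi_zb w : D w -> levi F w *m zb w = \col_i dz (rshift n i) f w.
Proof.
move=> Dw; apply/matrixP => i j; rewrite !ord1 !mxE -(euler_dz potF _ Dw).
by apply: eq_bigr => l _; rewrite !mxE mulrC.
Qed.

Lemma zt_levi w : D w -> zt w *m levi F w = \row_j dzb (rshift n j) f w.
Proof.
move=> Dw; apply/matrixP => i j; rewrite !ord1 !mxE -(euler_dzb potF _ Dw).
by apply: eq_bigr => l _; rewrite !mxE.
Qed.

Lemma zt_levi_zb w : D w -> zt w *m levi F w *m zb w = (f w)%:M.
Proof.
move=> Dw; rewrite zt_levi//; apply/matrixP => i j.
rewrite !ord1 !mxE eqxx mulr1n -[RHS](euler_conj potF Dw).
by apply: eq_bigr => l _; rewrite !mxE mulrC.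
Qed.

(** The fiber block of the Levi form of the pullback of log F under
    v |-> c aff(v). *)
Definition fib_levi k c w : 'M[Cx R]_r.-1 :=
  \matrix_(a, b) (c * c^* *
    dz (rshift n (lift k a)) (dzb (rshift n (lift k b)) L) w).

(** The differential of v |-> c aff(v); its image consists of the vectors with
    vanishing k-th entry. *)
Definition chart_mx k c : 'M[Cx R]_(r.-1, r) := \matrix_(a, i) (c *+ (i == lift k a)).

Lemma chart_mx_mul k c m (X : 'M[Cx R]_(r, m)) a j :
  (chart_mx k c *m X) a j = c * X (lift k a) j.
Proof.
rewrite mxE (bigD1 (lift k a))//= big1 ?addr0 ?mxE ?eqxx// => i /negbTE il.
by rewrite mxE il mul0r.
Qed.

Lemma mul_chart_mx k c m (X : 'M[Cx R]_(m, r)) i b :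
  (X *m (chart_mx k c)^T) i b = c * X i (lift k b).
Proof.
rewrite mxE (bigD1 (lift k b))//= big1 ?addr0 ?mxE ?eqxx ?[c * _]mulrC// => j /negbTE jl.
by rewrite !mxE jl mulr0.
Qed.

Lemma ord_lift_ind k (P : 'I_r -> Prop) : P k -> (forall a, P (lift k a)) -> forall i, P i.
Proof. by move=> Pk Pl i; case: (unliftP k i) => [a ->|->]. Qed.

(** Passing from F to log F and from C^r to the chart divides the Schur complement
    by F and changes it in no other way. *)
Lemma log_schur k c w (al be : 'I_n) : D w -> c != 0 -> zt w 0 k != 0 ->
  levi F w \in unitmx -> fib_levi k c w \in unitmx ->
  dz (lshift r al) (dzb (lshift r be) L) w -
  \sum_a \sum_b (c^* * dz (lshift r al) (dzb (rshift n (lift k b)) L) w)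
     * invmx (fib_levi k c w) b a
     * (c * dz (rshift n (lift k a)) (dzb (lshift r be) L) w) =
  (dz (lshift r al) (dzb (lshift r be) f) w -
     \sum_k \sum_l dz (lshift r al) (dzb (rshift n l) f) w * invmx (levi F w) l k
       * dz (rshift n k) (dzb (lshift r be) f) w) / f w.
Proof.
move=> Dw c0 zk Hu Au.
have g0 : f w != 0 by rewrite ofreal_eq0 gt_eqF// (potential_gt0 potF).
have cc0 : c^* != 0 by rewrite conjC_eq0.
have AE : chart_mx k c *m ((f w)^-1 *: levi F w - (f w) ^- 2 *:
    (levi F w *m zb w *m (zt w *m levi F w))) *m (chart_mx k c^*)^T = fib_levi k c w.
  apply/matrixP => a b; rewrite mul_chart_mx chart_mx_mul [RHS]mxE (log_levi potF)//.
  by rewrite zt_levi// levi_zb// !mxE big_ord1 !mxE; field.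
have span (x : 'cV[Cx R]_r) : exists y t, x = (chart_mx k c^*)^T *m y + t *: zb w.
  exists (\col_a ((x (lift k a) 0 - x k 0 / (zt w 0 k)^* * (zt w 0 (lift k a))^*) / c^*)).
  exists (x k 0 / (zt w 0 k)^*); apply/matrixP => i j; rewrite !ord1 {j}.
  have zk' : (zt w 0 k)^* != 0 by rewrite conjC_eq0.
  rewrite mxE [X in X + _]mxE.
  elim/(@ord_lift_ind k): i => [|a].
    rewrite big1 ?add0r; first by rewrite !mxE; rewrite mxE in zk'; field.
    by move=> a _; rewrite !mxE (negbTE (neq_lift k a)) mul0r.
  rewrite (bigD1 a)//= big1 ?addr0; last first.
    by move=> b ba; rewrite !mxE (inj_eq lift_inj) eq_sym (negbTE ba) mul0r.
  rewrite !mxE eqxx mulr1n; rewrite !mxE in zk' *; field.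
  by rewrite cc0 zk'.
have := schur_projective (row_ (lshift r al) w) (col_ (lshift r be) w)
  (dz (lshift r al) (dzb (lshift r be) f) w)%:M AE Hu (zt_levi_zb Dw) g0 span Au.
rewrite row_zb// zt_col// zt_levi// levi_zb// => /matrixP/(_ 0 0) E.
have subE (X Y : 'M[Cx R]_1) : (X - Y) 0 0 = X 0 0 - Y 0 0 by rewrite !mxE.
have scaleE x (X : 'M[Cx R]_1) : (x *: X) 0 0 = x * X 0 0 by rewrite mxE.
rewrite subE !scaleE !subE in E; rewrite !(@mulmx3E (Cx R)) in E.
transitivity ((f w)^-1 * (dz (lshift r al) (dzb (lshift r be) f) w -
  \sum_k \sum_l dz (lshift r al) (dzb (rshift n l) f) w * invmx (levi F w) l k
    * dz (rshift n k) (dzb (lshift r be) f) w)); last by rewrite mulrC.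
transitivity ((f w)^-1 *
  ((dz (lshift r al) (dzb (lshift r be) f) w)%:M (0 : 'I_1) (0 : 'I_1) -
  \sum_k \sum_l (row_ (lshift r al) w) 0 l
    * invmx (levi F w) l k
    * (col_ (lshift r be) w) k 0)); last first.
  rewrite [_%:M _ _]mxE mulr1n; congr (_ * (_ - _)).
  by apply: eq_bigr => i _; apply: eq_bigr => j _; rewrite !mxE.
rewrite -E; congr (_ - _).
  by rewrite !scaleE -scalar_mxM !mxE !eqxx !mulr1n (log_levi potF)//; field.
apply: eq_bigr => a _; apply: eq_bigr => b _; congr (_ * _ * _).
  by rewrite mul_chart_mx mul_scalar_mx !mxE (log_levi potF)//; field.
by rewrite chart_mx_mul mul_mx_scalar !mxE (log_levi potF)//; field.
Qed.

Lemma fib_levi_herm k c w (v : 'rV[Cx R]_r.-1) : D w ->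
  herm (fib_levi k c w) v v =
  herm (levi F w) (v *m chart_mx k c) (v *m chart_mx k c) / f w -
  herm (levi F w) (v *m chart_mx k c) (zt w) *
  herm (levi F w) (zt w) (v *m chart_mx k c) / f w ^+ 2.
Proof.
move=> Dw; set V := v *m _.
have VE (h : 'I_r -> Cx R) : \sum_i h i * V 0 i = \sum_a h (lift k a) * (c * v 0 a).
  under eq_bigr do rewrite mxE mulr_sumr.
  rewrite exchange_big/=; apply: eq_bigr => a _.
  rewrite (bigD1 (lift k a))//= big1 ?addr0 => [|i /negbTE il].
    by rewrite mxE eqxx mulr1n [v 0 a * _]mulrC.
  by rewrite mxE il mulr0n !mulr0.
have VcE (h : 'I_r -> Cx R) : \sum_i h i * (V 0 i)^* =
    \sum_a h (lift k a) * (c * v 0 a)^*.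
  apply: (inv_inj conjCK); rewrite !rmorph_sum/=.
  under eq_bigr do rewrite rmorphM/= conjCK.
  by rewrite (VE (fun i => (h i)^*)); apply: eq_bigr => a _; rewrite !rmorphM/= !conjCK.
have H1 : herm (levi F w) V (zt w) =
    \sum_a dz (rshift n (lift k a)) f w * (c * v 0 a).
  rewrite -(VE (fun i => dz (rshift n i) f w)); apply: eq_bigr => i _.
  rewrite -(euler_dz potF _ Dw) mulr_suml; apply: eq_bigr => j _.
  by rewrite !mxE; ring.
have H2 : herm (levi F w) (zt w) V =
    \sum_b dzb (rshift n (lift k b)) f w * (c * v 0 b)^*.
  rewrite -(VcE (fun i => dzb (rshift n i) f w)) /herm exchange_big/=.
  apply: eq_bigr => j _; rewrite -(euler_dzb potF _ Dw) mulr_suml; apply: eq_bigr => i _.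
  by rewrite !mxE; ring.
have H3 : herm (levi F w) V V = \sum_a \sum_b
    dz (rshift n (lift k a)) (dzb (rshift n (lift k b)) f) w *
    (c * v 0 a) * (c * v 0 b)^*.
  rewrite /herm; under eq_bigr => i _ do rewrite (VcE (fun j => levi F w i j * V 0 i)).
  rewrite exchange_big [RHS]exchange_big/=; apply: eq_bigr => b _.
  under eq_bigr do rewrite mulrAC.
  rewrite (VE (fun i => levi F w i (lift k b) * (c * v 0 b)^*)); apply: eq_bigr => a _.
  by rewrite mxE mulrAC.
rewrite H1 H2 H3 big_distrlr/= !mulr_suml -sumrB; apply: eq_bigr => a _.
rewrite !mulr_suml -sumrB; apply: eq_bigr => b _.
by rewrite mxE (log_levi potF)// rmorphM; ring.
Qed.

(** Chart directions have vanishing k-th entry while zeta^k does not vanish, so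
    they are transversal to the line of zeta and Cauchy-Schwarz is strict. *)
Lemma posdef_fib_levi k c w : D w -> c != 0 -> zt w 0 k != 0 ->
  posdef (levi F w) -> posdef (fib_levi k c w).
Proof.
move=> Dw c0 zk pH v v0; rewrite -/(herm _ _ _) fib_levi_herm//.
have gE : herm (levi F w) (zt w) (zt w) = f w.
  by rewrite hermE zt_levi_zb// mxE eqxx mulr1n.
rewrite -gE; apply: log_levi_gt0 => //.
- move=> a; apply/eqP => /rowP Va.
  have vk : (v *m chart_mx k c) 0 k = 0.
    rewrite mxE big1 // => b _.
    by rewrite mxE (negbTE (neq_lift k b)) mulr0n mulr0.
  have a0 : a = 0.
    by apply/eqP; move/eqP: (Va k); rewrite vk mxE eq_sym mulf_eq0 (negbTE zk) orbF.
  move/eqP: v0; apply; apply/rowP => b.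
  have := Va (lift k b); rewrite a0 [RHS]mxE mul0r mxE (bigD1 b)//= big1.
    rewrite mxE eqxx mulr1n addr0 => /eqP.
    by rewrite mulf_eq0 (negbTE c0) orbF => /eqP ->; rewrite mxE.
  by move=> b' b'b; rewrite mxE (inj_eq lift_inj) eq_sym (negbTE b'b) mulr0n mulr0.
- by case: Dw.
- set V := v *m _; rewrite /herm exchange_big/=.
  transitivity (\sum_j dzb (rshift n j) f w * (V 0 j)^*).
    apply: eq_bigr => j _; rewrite -(euler_dzb potF _ Dw) mulr_suml.
    by apply: eq_bigr => i _; rewrite [levi _ _ _ _]mxE; ring.
  rewrite rmorph_sum/=; apply: eq_bigr => j _.
  rewrite -(conj_dz potF _ Dw) -(euler_dz potF _ Dw) -rmorphM mulr_suml.
  by congr (_^*); apply: eq_bigr => i _; rewrite [levi _ _ _ _]mxE; ring.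
Qed.

End LogPotential.

(** * Affine charts of the projectivization *)

Section AffineChart.
Variables (R : realType) (n r : nat).
Implicit Types (w : 'rV[Cx R]_(n + r.-1)) (k : 'I_r) (c : Cx R).
Implicit Types (p q : 'I_(n + r.-1)).

(** The scale [c] lets a chart reach every nonzero vector of the fiber, not only
    those with k-th entry 1. *)
Definition chart_map k c w : 'rV[Cx R]_(n + r) :=
  row_mx (lsubmx w) (c *: aff k (rsubmx w)).

(** [chart_idx] and [chart_scale] describe the differential of [chart_map]: the
    coordinate direction q goes to a multiple of another coordinate
    direction. *)
Definition chart_idx k q : 'I_(n + r) :=
  match fintype.split q with inl al => lshift r al | inr a => rshift n (lift k a) end.

Definition chart_scale c q : Cx R := if fintype.split q is inl _ then 1 else c.

Lemma split_lshift (al : 'I_n) : fintype.split (lshift r.-1 al) = inl al.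
Proof. exact: (unsplitK (inl al)). Qed.

Lemma split_rshift (a : 'I_r.-1) : fintype.split (rshift n a) = inr a.
Proof. exact: (unsplitK (inr a)). Qed.

Lemma chart_idx_base k al : chart_idx k (lshift r.-1 al) = lshift r al.
Proof. by rewrite /chart_idx split_lshift. Qed.

Lemma chart_idx_fib k a : chart_idx k (rshift n a) = rshift n (lift k a).
Proof. by rewrite /chart_idx split_rshift. Qed.

Lemma chart_scale_base c al : chart_scale c (lshift r.-1 al) = 1.
Proof. by rewrite /chart_scale split_lshift. Qed.

Lemma chart_scale_fib c a : chart_scale c (rshift n a) = c.
Proof. by rewrite /chart_scale split_rshift. Qed.

Lemma aff_k k (v : 'rV[Cx R]_r.-1) : aff k v 0 k = 1.
Proof. by rewrite mxE unlift_none. Qed.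

Lemma aff_lift k (v : 'rV[Cx R]_r.-1) a : aff k v 0 (lift k a) = v 0 a.
Proof. by rewrite mxE liftK. Qed.

Lemma chart_map_line k c w (x : Cx R) q :
  chart_map k c (w + x *: delta_mx 0 q) =
  chart_map k c w + (x * chart_scale c q) *: delta_mx 0 (chart_idx k q).
Proof.
apply/rowP => j; rewrite /chart_map [RHS]mxE [(_ *: delta_mx _ _) _ _]mxE.
rewrite [delta_mx _ (chart_idx _ _) _ _]mxE eqxx/=.
case: (split_ordP j) => [b ->|i ->].
  rewrite !row_mxEl !mxE eqxx/=.
  case: (split_ordP q) => [al ->|a ->].
    by rewrite chart_idx_base chart_scale_base !eq_lshift mulr1.
  by rewrite chart_idx_fib !eq_lrshift !mulr0.
rewrite !row_mxEr ![(c *: aff _ _) _ _]mxE; elim/(@ord_lift_ind r k): i => [|a].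
  rewrite !aff_k; case: (split_ordP q) => [al ->|a ->].
    by rewrite chart_idx_base eq_rlshift mulr0 addr0.
  by rewrite chart_idx_fib eq_rshift (negbTE (neq_lift k a)) mulr0 addr0.
rewrite !aff_lift !mxE eqxx/=; case: (split_ordP q) => [al ->|b ->].
  by rewrite chart_idx_base !eq_rlshift !mulr0 !addr0.
rewrite chart_idx_fib chart_scale_fib !eq_rshift (inj_eq lift_inj); ring.
Qed.

Lemma chart_map_dirs k c q w :
  (forall t, chart_map k c (w + ofreal t *: delta_mx 0 q) = chart_map k c w +
     ofreal t *: (chart_scale c q *: delta_mx 0 (chart_idx k q))) /\
  (forall t, chart_map k c (w + ofreal t *: ('i *: delta_mx 0 q)) =
     chart_map k c w +
     ofreal t *: ('i *: (chart_scale c q *: delta_mx 0 (chart_idx k q)))).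
Proof.
split=> t; first by rewrite chart_map_line scalerA.
by rewrite scalerA chart_map_line !scalerA.
Qed.

Lemma wirt_chart k c s q (h : 'rV[Cx R]_(n + r) -> Cx R) w :
  wirt s (delta_mx 0 q) (h \o chart_map k c) w =
  wirt s (chart_scale c q *: delta_mx 0 (chart_idx k q)) h (chart_map k c w).
Proof.
have [E1 E2] := chart_map_dirs k c q w.
by rewrite /wirt (dirD_comp h E1).1 (dirD_comp h E2).1.
Qed.

Lemma wirt_derivable_chart k c q (h : 'rV[Cx R]_(n + r) -> Cx R) w :
  wirt_derivable (chart_scale c q *: delta_mx 0 (chart_idx k q)) h
    (chart_map k c w) ->
  wirt_derivable (delta_mx 0 q) (h \o chart_map k c) w.
Proof.
have [E1 E2] := chart_map_dirs k c q w.
by move=> [d1 d2]; split; [exact: (dirD_comp h E1).2|exact: (dirD_comp h E2).2].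
Qed.

Lemma chart_map_continuous k c : continuous (chart_map k c).
Proof.
move=> w; apply: rV_continuous => j; rewrite /chart_map.
case: (split_ordP j) => [al ->|i ->].
  apply: (@continuous_ext R _ (fun w => w 0 (lshift r.-1 al)));
    last exact: continuous_coord.
  by move=> v; rewrite row_mxEl mxE.
elim/(@ord_lift_ind r k): i => [|a].
  apply: (@continuous_ext R _ (fun=> c)); last exact: cst_continuous.
  by move=> v; rewrite row_mxEr mxE aff_k mulr1.
apply: (@continuous_ext R _ (fun w => c * w 0 (rshift n a))).
  by move=> v; rewrite row_mxEr mxE aff_lift mxE.
by apply: continuous_mul; [exact: cst_continuous|exact: continuous_coord].
Qed.

Variables (Z : set 'rV[Cx R]_n) (F : 'rV[Cx R]_(n + r) -> R).
Hypothesis potF : homogeneous_potential Z F.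

Local Notation D := (off_zero Z).
Local Notation L := (fun y => ofreal (ln (F y))).

Let chart_dom k c := [set w | D (chart_map k c w)].

Lemma open_chart k c : open (chart_dom k c).
Proof.
rewrite /chart_dom; apply: (@open_comp _ _ (chart_map k c) D) (potential_open potF) => w _.
exact: chart_map_continuous.
Qed.

(** The additive constant [x] is there because rescaling the chart adds a
    constant to log F. *)
Lemma chart_levi k c x p q w : D (chart_map k c w) ->
  dz p (dzb q (fun w => ofreal (ln (F (chart_map k c w))) + x)) w =
  chart_scale c p * (chart_scale c q)^* *
    dz (chart_idx k p) (dzb (chart_idx k q) L) (chart_map k c w).
Proof.
move=> Dw; have oD := potential_open potF; have sL := smooth_log potF.
have sdL := smooth_dzb potF (chart_idx k q) sL.
have E w' : chart_dom k c w' ->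
    dzb q (fun w => ofreal (ln (F (chart_map k c w))) + x) w' =
    (chart_scale c q)^* * dzb (chart_idx k q) L (chart_map k c w').
  move=> Dw'; rewrite dzbE wirt_add_cst; last first.
    apply: (@wirt_derivable_chart k c q L); exact: smooth_wirt_derivable_dir oD sL Dw'.
  by rewrite (wirt_chart k c _ q L) (dzb_scale _ _ oD sL Dw').
rewrite dzE (wirt_open _ _ (@open_chart k c) Dw E) wirtZ; last first.
  apply: (@wirt_derivable_chart k c p (dzb (chart_idx k q) L)).
  exact: smooth_wirt_derivable_dir oD sdL Dw.
rewrite (wirt_chart k c _ p (dzb (chart_idx k q) L)) (dz_scale _ _ oD sdL Dw).
by rewrite mulrCA mulrA.
Qed.

Lemma smooth_chart k : smooth (chart_dom k 1) (fun w => ofreal (ln (F (chart_map k 1 w)))).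
Proof.
move=> l; apply: (@Ck_comp _ _ _ l (chart_map k 1) (chart_idx k) _ D L).
- exact: chart_map_continuous.
- by [].
- move=> z j b t; rewrite /rdir; case: b.
    rewrite scalerA chart_map_line scalerA; congr (_ + _ *: _).
    by rewrite /chart_scale; case: (fintype.split _) => _; rewrite mulr1.
  rewrite scalerA chart_map_line scalerA; congr (_ + _ *: _).
  by rewrite /chart_scale; case: (fintype.split _) => _; rewrite mulr1.
- exact: smooth_log potF l.
Qed.

End AffineChart.

(** * The dual metric on the hyperplane bundle *)

Section DualMetric.
Variables (R : realType) (n r : nat) (M : complexManifold R n).
Variables (E : holBundle M r) (G : forall x : M, E x -> R).
Hypothesis finslerG : finsler_metric G.

Lemma normsqM (a b : Cx R) : normsq (a * b) = normsq a * normsq b.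
Proof. by case: a b => [a1 a2] [b1 b2]; rewrite /normsq/=; ring. Qed.

Lemma normsq_gt0 (a : Cx R) : a != 0 -> 0 < normsq a.
Proof.
move=> a0; rewrite lt_def addr_ge0 ?sqr_ge0// andbT.
apply: contraNneq a0 => /eqP; rewrite paddr_eq0 ?sqr_ge0// !sqrf_eq0.
by case: a => [x y] /= /andP[/eqP -> /eqP ->].
Qed.

Lemma finsler_gt0 x (u : E x) : u != 0 -> 0 < G u.
Proof.
move=> u0; rewrite lt_def (finsler_ge0 finslerG) andbT.
by apply: contraNneq u0 => /(finsler_eq0 finslerG) ->.
Qed.

Lemma fcomb_neq0 (e : frame E r) x zeta : zeta != 0 -> fcomb e x zeta != 0.
Proof.
apply: contraNneq => u0; apply/eqP/rowP => k.
by rewrite -(fcomb_coord e x zeta k) u0 linear0 mxE.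
Qed.

Lemma fcombZ (e : frame E r) x a zeta : fcomb e x (a *: zeta) = a *: fcomb e x zeta.
Proof. by rewrite scaler_sumr; apply: eq_bigr => i _; rewrite mxE scalerA. Qed.

Lemma Gloc_gt0 c (e : frame E r) w : rsubmx w != 0 -> 0 < Gloc G c e w.
Proof. by move=> w0; apply: finsler_gt0; exact: fcomb_neq0. Qed.

Lemma Gloc_homog c (e : frame E r) w a :
  Gloc G c e (row_mx (lsubmx w) (a *: rsubmx w)) = normsq a * Gloc G c e w.
Proof. by rewrite /Gloc row_mxKl row_mxKr fcombZ (finsler_homog finslerG). Qed.

Lemma aff_neq0 k (v : 'rV[Cx R]_r.-1) : aff k v != 0.
Proof.
by apply/eqP => /rowP/(_ k)/eqP; rewrite aff_k mxE oner_eq0.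
Qed.

Lemma PEpoint_gen (e : frame E r) x k v (L := PEpoint e x k v) :
  exists2 u : taut L, vsval u = fcomb e x (aff k v) & O1frame e k L u = 1.
Proof.
have uL : fcomb e x (aff k v) \in val L by exact: memv_line.
exists (Subvs uL) => //.
have := lfunE [the {linear taut L -> (Cx R)^o} of coord (fvec e x) k \o vsval] (Subvs uL).
rewrite /O1frame => -> /=.
by rewrite fcomb_coord aff_k.
Qed.

Lemma dual_frame (e : frame E r) x k v :
  dual_metric G (O1frame e k (PEpoint e x k v)) = (G (fcomb e x (aff k v)))^-1.
Proof.
have [u uE u1] := PEpoint_gen e x k v.
have := dual_metricE (O1frame e k (PEpoint e x k v)) u finslerG.
rewrite u1 uE => H.
have g0 : G (fcomb e x (aff k v)) != 0.
  by rewrite gt_eqF// finsler_gt0// fcomb_neq0// aff_neq0.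
by apply: (mulIf g0); rewrite H mulVf// /normsq/= expr1n expr0n addr0.
Qed.

Lemma weight_dual c (e : frame E r) k w :
  weight (dual_metric G) c e k w = ln (Gloc G c e (chart_map k 1 w)).
Proof.
rewrite /weight dual_frame lnV ?opprK; last first.
  by rewrite posrE finsler_gt0// fcomb_neq0// aff_neq0.
by rewrite /Gloc row_mxKl row_mxKr scale1r.
Qed.

(** By homogeneity the weight is log F in every rescaled chart, up to a constant
    invisible to its derivatives. *)
Lemma weight_dual_scale c (e : frame E r) k a w : a != 0 ->
  weight (dual_metric G) c e k w =
  ln (Gloc G c e (chart_map k a w)) - ln (normsq a).
Proof.
move=> a0; rewrite weight_dual.
have -> : chart_map k a w =
    row_mx (lsubmx (chart_map k 1 w)) (a *: rsubmx (chart_map k 1 w)).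
  by rewrite row_mxKl row_mxKr scale1r.
rewrite Gloc_homog lnM ?posrE ?normsq_gt0//.
  by rewrite [ln (normsq a) + _]addrC addrK.
by apply: Gloc_gt0; rewrite row_mxKr scale1r aff_neq0.
Qed.

Lemma dual_metric_gt0 x (L : PEfiber E x) (s : O1 L) : s != 0 -> 0 < dual_metric G s.
Proof.
move=> s0; rewrite /dual_metric; set p := vpick fullv.
have dimL : \dim {:taut L} = 1%N by rewrite dimvf; apply/eqP; case: L s s0 p.
have p0 : p != 0 by rewrite vpick0 -dimv_eq0 dimL.
apply: divr_gt0; last first.
  apply: finsler_gt0; apply/eqP => p00; move/eqP: p0; apply.
  by apply/val_inj; exact: etrans p00 (esym (linear0 _)).
apply: normsq_gt0; apply: contraNneq s0 => sp0; apply/eqP/lfunP => u.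
have /vlineP[a ->] : u \in <[p]>%VS.
  suff -> : <[p]>%VS = fullv by exact: memvf.
  by apply/eqP; rewrite eqEdim subvf dimL dim_vline p0.
by rewrite linearZ/= sp0 scaler0 lfunE.
Qed.

Lemma dual_metric_homog x (L : PEfiber E x) a (s : O1 L) :
  dual_metric G (a *: s) = normsq a * dual_metric G s.
Proof. by rewrite /dual_metric lfunE/= normsqM mulrA. Qed.

End DualMetric.

(** Inside the open image of the chart, membership is the condition that
    [cinv] lands in the open domain of the frame. *)
Lemma open_zdom (R : realType) (n r : nat) (M : complexManifold R n)
  (E : holBundle M r) (c : chart R n M) (e : frame E r) : open (zdom c e).
Proof.
rewrite openE => z [x [cx ex] <-].
have nc : nbhs (cmap c x) (cmap c @` cdom c).
  by apply: open_nbhs_nbhs; split; [exact: cimg_open|exists x].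
have ne : nbhs (cmap c x) (cinv c @^-1` fdom e).
  apply: cinv_continuous; first by exists x.
  by rewrite (cmapK cx); apply: open_nbhs_nbhs; split; [exact: fdom_open|].
near=> y.
have [x' cx' yE] : (cmap c @` cdom c) y by near: y; exact: nc.
have ey : fdom e (cinv c y) by near: y; exact: ne.
exists x' => //; split=> //.
by move: ey; rewrite -yE (cmapK cx').
Unshelve. all: by end_near. Qed.

(** * Comparison of the two curvatures *)

Section FinslerCurvature.
Variables (R : realType) (n r : nat) (M : complexManifold R n).
Variables (E : holBundle M r) (G : forall x : M, E x -> R).
Hypothesis finslerG : finsler_metric G.
Hypothesis convexG : strongly_pseudoconvex G.
Variables (g : hermitian_form M) (c : chart R n M) (e : frame E r).
Hypotheses (atlas_c : atlas M c) (frames_e : frames E e).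

Implicit Types (k : 'I_r) (a : Cx R).

Local Notation Gce := (Gloc G c e).
Local Notation D := (@off_zero R n r (zdom c e)).

Lemma Gloc_potential : homogeneous_potential (zdom c e) Gce.
Proof.
split.
- have -> : D = (@lsubmx (Cx R) 1 n r @^-1` zdom c e) `&`
      (@rsubmx (Cx R) 1 n r @^-1` [set v | v != 0]) by [].
  apply: openI; apply: open_comp.
  + move=> w _; apply: rV_continuous => j.
    apply: (@continuous_ext R _ (fun y : 'rV_(n + r) => y 0 (lshift r j))).
      by move=> v; rewrite mxE.
    exact: continuous_coord.
  + exact: open_zdom.
  + move=> w _; apply: rV_continuous => j.
    apply: (@continuous_ext R _ (fun y : 'rV_(n + r) => y 0 (rshift n j))).
      by move=> v; rewrite mxE.
    exact: continuous_coord.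
  + exact: open_neq0.
- by move=> w [_ w0]; exact: Gloc_gt0.
- exact: finsler_smooth finslerG _ _ atlas_c frames_e.
- by move=> w a; exact: Gloc_homog.
Qed.

Lemma Gmx_levi w : Gmx G c e w = levi Gce w.
Proof. by apply/matrixP => i j; rewrite !mxE. Qed.

Lemma KcurvE i j al be w : Kcurv G c e i j al be w =
  - dz (lshift r al) (dzb (lshift r be)
      (dz (rshift n i) (dzb (rshift n j) (fun y => ofreal (Gce y))))) w +
  \sum_k \sum_l invmx (levi Gce w) l k *
    dz (lshift r al) (dz (rshift n i) (dzb (rshift n l) (fun y => ofreal (Gce y)))) w *
    dzb (lshift r be) (dz (rshift n k) (dzb (rshift n j) (fun y => ofreal (Gce y)))) w.
Proof.
have GmxE i' j' : (fun y => Gmx G c e y i' j') =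
    dz (rshift n i') (dzb (rshift n j') (fun y => ofreal (Gce y))).
  by apply: funext => y; rewrite mxE.
rewrite /Kcurv Gmx_levi (GmxE i j); congr (_ + _).
apply: eq_bigr => k _; apply: eq_bigr => l _.
by rewrite (GmxE i l) (GmxE k j).
Qed.

Lemma chart_map_D k a w : zdom c e (lsubmx w) -> a != 0 -> D (chart_map k a w).
Proof.
move=> zw a0; split; rewrite /chart_map ?row_mxKl// row_mxKr.
by rewrite scaler_eq0 (negbTE a0) (negbTE (aff_neq0 k _)).
Qed.

Lemma weight2_dual k a p q w : zdom c e (lsubmx w) -> a != 0 ->
  weight2 (dual_metric G) c e k p q w =
  chart_scale a p * (chart_scale a q)^* *
    dz (chart_idx k p) (dzb (chart_idx k q) (fun y => ofreal (ln (Gce y))))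
       (chart_map k a w).
Proof.
move=> zw a0.
rewrite -(chart_levi Gloc_potential (ofreal (- ln (normsq a))) _ _ (chart_map_D k zw a0)).
rewrite /weight2; congr (dz p (dzb q _) w); apply: funext => y.
by rewrite (weight_dual_scale finslerG c e k y a0) ofrealD.
Qed.

Lemma weight_fib_dual k a w : zdom c e (lsubmx w) -> a != 0 ->
  weight_fib (dual_metric G) c e k w = fib_levi Gce k a (chart_map k a w).
Proof.
move=> zw a0; apply/matrixP => i j; rewrite !mxE (weight2_dual k _ _ zw a0).
by rewrite !chart_scale_fib !chart_idx_fib.
Qed.

Lemma chart_map_k k a (w : 'rV[Cx R]_(n + r.-1)) : rsubmx (chart_map k a w) 0 k = a.
Proof. by rewrite row_mxKr mxE aff_k mulr1. Qed.

Lemma posdef_weight_fib k w : zdom c e (lsubmx w) ->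
  posdef (weight_fib (dual_metric G) c e k w).
Proof.
move=> zw; have a0 : (1 : Cx R) != 0 by exact: oner_neq0.
have Dw := chart_map_D k zw a0.
rewrite (weight_fib_dual k zw a0); apply: (posdef_fib_levi Gloc_potential) => //.
  by rewrite chart_map_k.
by rewrite -Gmx_levi; case: Dw; exact: convexG.
Qed.

Definition finsler_mean (w : 'rV[Cx R]_(n + r)) : Cx R :=
  \sum_(al < n) \sum_(be < n) \sum_(i < r) \sum_(j < r)
      invmx (g c (cinv c (lsubmx w))) be al * Kcurv G c e i j al be w
      * rsubmx w 0 i * (rsubmx w 0 j)^* / ofreal (Gce w).

(** Both sides are traces of Schur complements of Levi forms: that of log G in a
    chart of P(E) on the left, that of G, divided by G, on the right. *)
Lemma tr_c_dual k a w : zdom c e (lsubmx w) -> a != 0 ->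
  tr_c g (dual_metric G) c e k w = - finsler_mean (chart_map k a w).
Proof.
move=> zw a0; have Dw := chart_map_D k zw a0.
set w0 := chart_map k a w in Dw *.
have w0l : lsubmx w0 = lsubmx w by rewrite row_mxKl.
have Hu : levi Gce w0 \in unitmx.
  by apply: posdef_unitmx; rewrite -Gmx_levi; case: Dw; exact: convexG.
have Au : fib_levi Gce k a w0 \in unitmx.
  by rewrite -weight_fib_dual//; apply: posdef_unitmx; exact: posdef_weight_fib.
rewrite /tr_c /finsler_mean w0l -sumrN; apply: eq_bigr => al _.
rewrite -sumrN; apply: eq_bigr => be _.
set gi := invmx _ be al.
transitivity (gi * - ((\sum_i \sum_j Kcurv G c e i j al be w0
      * rsubmx w0 0 i * (rsubmx w0 0 j)^*) / ofreal (Gce w0))); last first.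
  rewrite mulrN; congr (- _); rewrite mulr_suml mulr_sumr; apply: eq_bigr => i _.
  by rewrite mulr_suml mulr_sumr; apply: eq_bigr => j _; rewrite !mulrA.
congr (_ * _).
have -> : \sum_i \sum_j Kcurv G c e i j al be w0 * rsubmx w0 0 i * (rsubmx w0 0 j)^* =
  - (dz (lshift r al) (dzb (lshift r be) (fun w => ofreal (Gce w))) w0 -
     \sum_k \sum_l dz (lshift r al) (dzb (rshift n l) (fun w => ofreal (Gce w))) w0
       * invmx (levi Gce w0) l k
       * dz (rshift n k) (dzb (lshift r be) (fun w => ofreal (Gce w))) w0).
  rewrite -(curvature_contraction Gloc_potential al be Dw).
  by apply: eq_bigr => i _; apply: eq_bigr => j _; rewrite KcurvE.
rewrite mulNr opprK.
rewrite -(log_schur Gloc_potential al be Dw a0 _ Hu Au); last by rewrite chart_map_k.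
rewrite (weight2_dual k _ _ zw a0) !chart_scale_base !chart_idx_base rmorph1 !mul1r.
congr (_ - _); apply: eq_bigr => b _; apply: eq_bigr => b' _.
rewrite !(weight2_dual k _ _ zw a0) (weight_fib_dual k zw a0).
rewrite !chart_scale_base !chart_idx_base !chart_scale_fib !chart_idx_fib.
by rewrite rmorph1 mul1r mulr1.
Qed.

Lemma chart_map_onto w0 : D w0 ->
  exists k a w, [/\ a != 0, zdom c e (lsubmx w) & chart_map k a w = w0].
Proof.
move=> [z0 v0]; have [k ak] : exists k, rsubmx w0 0 k != 0.
  apply/existsP; apply: contra_neqT v0; rewrite negb_exists => /forallP H.
  by apply/rowP => j; rewrite [RHS]mxE; apply/eqP; move: (H j); rewrite negbK.
exists k, (rsubmx w0 0 k),
  (row_mx (lsubmx w0) (\row_b (rsubmx w0 0 (lift k b) / rsubmx w0 0 k))).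
split=> //; first by rewrite row_mxKl.
rewrite /chart_map row_mxKl row_mxKr -[RHS]hsubmxK; congr row_mx.
apply/rowP => i; rewrite mxE; elim/(@ord_lift_ind r k): i => [|b].
  by rewrite aff_k mulr1.
by rewrite aff_lift [X in _ * X]mxE [LHS]mulrC divfK.
Qed.

End FinslerCurvature.

Lemma dual_O1_metric (R : realType) (n r : nat) (M : complexManifold R n)
    (E : holBundle M r) (G : forall x : M, E x -> R) :
  finsler_metric G -> O1_metric (dual_metric G).
Proof.
move=> finslerG; split.
- by move=> x L s; exact: dual_metric_gt0.
- by move=> x L a s; exact: dual_metric_homog.
move=> c e k Hc He l.
have potG := Gloc_potential finslerG Hc He.
have a0 : (1 : Cx R) != 0 by exact: oner_neq0.
have := smooth_chart potG k l.
rewrite (_ : (fun w => _) = fun w => ofreal (weight (dual_metric G) c e k w)); last first.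
  by apply: funext => w; rewrite weight_dual.
congr (Ck l _ _); apply/seteqP; split=> w /=.
- by move=> [+ _]; rewrite row_mxKl.
- by move=> zw; exact: chart_map_D.
Qed.

Theorem lemma3p6 (R : realType) (n r : nat) (M : complexManifold R n)
  (cptM : compact [set: M]) (g : hermitian_form M) (kahlerg : kahler g)
  (E : holBundle M r) (G : forall x : M, E x -> R)
  (finslerG : finsler_metric G) (convexG : strongly_pseudoconvex G) :
  finsler_einstein g G <-> geodesic_einstein g (dual_metric G).
Proof.
have a0 : (1 : Cx R) != 0 by exact: oner_neq0.
split=> [[lambda FE]|[_ _ [lambda GE]]].
- split.
  + exact: dual_O1_metric.
  + by move=> c e k Hc He w zw; exact: posdef_weight_fib.
  + exists (- lambda) => c e k Hc He w zw.
    rewrite (tr_c_dual finslerG convexG g Hc He k zw a0); congr (- _).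
    by have [zw' w0] := chart_map_D k zw a0; exact: FE.
- exists (- lambda) => c e Hc He w zw w0.
  have [k [a [w' [a1 zw' <-]]]] := chart_map_onto (conj zw w0).
  by rewrite -(GE c e k Hc He w' zw') (tr_c_dual finslerG convexG g Hc He k zw' a1) opprK.
Qed.
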